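(* Let $\Gamma$ be a finitely generated group, and suppose we have an oracle that solves the word problem over $\Gamma$ in time $\phi(n)$ on input words of length $n$. Let $(G,\gamma)$ be a connected $\Gamma$-labeled graph with $m$ edges such that every arc is labeled by a word of length $1$ (over the generators of $\Gamma$ and their inverses), and let $a,b$ be vertices of $G$. Then one can decide in time $\mathcal{O}(m^2)\cdot\phi(12m)$ whether every Eulerian trail of $G$ from $a$ to $b$ has the same label. Moreover, if not, then one can find two Eulerian trails of $G$ from $a$ to $b$ with different labels in time $\mathcal{O}(m^4)\cdot\phi(12m)$.
   Context: Graphs are finite and undirected, with parallel edges and loops allowed. Each edge $e$ has two orientations (arcs) $\vec e$ and $\vec e^{-1}$, each with a tail and a head. A group-labeled graph $(G,\gamma)$ consists of a graph $G$ and a function $\gamma$ assigning to each arc an element of a group $\Gamma$ (written multiplicatively, identity $1$) such that $\gamma(\vec e^{-1})=\gamma(\vec e)^{-1}$ for every edge $e$. A trail is a sequence of arcs whose underlying edges are pairwise distinct and such that the head of each arc is the tail of the next; it goes from the tail of its first arc to the head of its last arc. Its label is the product $\gamma(\vec e_1)\gamma(\vec e_2)\cdots\gamma(\vec e_t)$ in order. A trail is Eulerian if it contains exactly one orientation of every edge of $G$. The word problem oracle takes a word over the generators of $\Gamma$ and their inverses (as formal symbols) and decides whether it equals the identity. The graph is given as an adjacency list in which each arc label is stored as a word over the generators and their inverses, and the label of $\vec e^{-1}$ is the formal inverse word of the label of $\vec e$.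
   Formalization: The oracle's time bound φ is assumed nondecreasing with φ(n) ≥ n, and for m = 0, where the stated bound would be zero, the decision procedure is only required to halt with the right answer. *)

(* Defs.v *)
From HB Require Import structures.
From mathcomp Require Import all_boot.

Set Implicit Arguments.
Unset Strict Implicit.
Unset Printing Implicit Defensive.

(* Parallel edges and loops are allowed.  [src]/[tgt] fix a reference
   orientation of each edge. *)
Record graph := Graph {
  nverts : nat;
  nedges : nat;
  src : 'I_nedges -> 'I_nverts;
  tgt : 'I_nedges -> 'I_nverts
}.

Section Graphs.
Variable G : graph.

Definition vertex := 'I_(nverts G).
Definition edge := 'I_(nedges G).

(* [(e, false)] is [e] with its reference orientation, [(e, true)] the
   opposite arc; a loop thus has two distinct arcs. *)
Definition arc_of := (edge * bool)%type.

Definition arc_edge (x : arc_of) : edge := x.1.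
Definition arc_inv (x : arc_of) : arc_of := (x.1, ~~ x.2).
Definition arc_tail (x : arc_of) : vertex := if x.2 then tgt x.1 else src x.1.
Definition arc_head (x : arc_of) : vertex := if x.2 then src x.1 else tgt x.1.

Definition adjacent : rel vertex :=
  fun u v => [exists x : arc_of, (arc_tail x == u) && (arc_head x == v)].

Definition connected_graph : Prop :=
  0 < nverts G /\ forall u v : vertex, connect adjacent u v.

(* Only for an empty sequence of arcs are the end vertices not determined by
   the arcs; it goes from every vertex to itself. *)
Fixpoint walk (a b : vertex) (s : seq arc_of) : bool :=
  if s is x :: s' then (arc_tail x == a) && walk (arc_head x) b s' else a == b.

Definition trail (a b : vertex) (s : seq arc_of) : bool :=
  walk a b s && uniq [seq arc_edge x | x <- s].

Definition eulerian_trail (a b : vertex) (s : seq arc_of) : Prop :=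
  trail a b s /\ forall e : edge, e \in [seq arc_edge x | x <- s].

Definition arc_code (x : arc_of) : nat :=
  if x.2 then nedges G + x.1 else x.1.

End Graphs.

Section Labels.
Local Open Scope group_scope.
Variable Gamma : groupType.

Definition group_labeling (G : graph) (gamma : arc_of G -> Gamma) : Prop :=
  forall x, gamma (arc_inv x) = (gamma x)^-1.

Definition trail_label (G : graph) (gamma : arc_of G -> Gamma) (s : seq (arc_of G))
  : Gamma := \prod_(x <- s) gamma x.

Definition same_eulerian_labels (G : graph) (gamma : arc_of G -> Gamma)
    (a b : vertex G) : Prop :=
  forall s1 s2, eulerian_trail a b s1 -> eulerian_trail a b s2 ->
    trail_label gamma s1 = trail_label gamma s2.

Variable k : nat.

(* [(i, false)] is the i-th generator and [(i, true)] its formal inverse. *)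
Definition letter := ('I_k * bool)%type.
Definition word := seq letter.

Definition letter_inv (l : letter) : letter := (l.1, ~~ l.2).
Definition word_inv (w : word) : word := rev [seq letter_inv l | l <- w].

Definition letter_code (l : letter) : nat := (if l.2 then k + l.1 else l.1)%N.

Variable gen : 'I_k -> Gamma.

Definition eval_letter (l : letter) : Gamma :=
  if l.2 then (gen l.1)^-1 else gen l.1.

Definition eval_word (w : word) : Gamma := \prod_(l <- w) eval_letter l.

Definition generates : Prop := forall g : Gamma, exists w, eval_word w = g.

(* Nothing is required of the answer on sequences that encode no word. *)
Definition solves_word_problem (oracle : seq nat -> bool) : Prop :=
  forall w : word,
    oracle [seq letter_code l | l <- w] <-> eval_word w = 1.

Definition word_labeling (G : graph) (gamma : arc_of G -> Gamma)
    (lab : arc_of G -> word) : Prop :=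
  forall x, eval_word (lab x) = gamma x /\ lab (arc_inv x) = word_inv (lab x).

End Labels.

(* A structured program for a RAM under the uniform cost criterion, with
   natural-number registers and finitely many (those the program mentions)
   unbounded arrays.  The arithmetic is limited to addition and truncated
   subtraction, so that unit cost per operation is a realistic measure. *)

Inductive expr :=
| ECst of nat
| EReg of nat
| EGet of nat & expr
| EAdd of expr & expr
| ESub of expr & expr
| ELt of expr & expr
| EEq of expr & expr.

Inductive cmd :=
| CSkip
| CSet of nat & expr
| CPut of nat & expr & expr
| CSeq of cmd & cmd
| CIf of expr & cmd & cmd
| CWhile of expr & cmd
| CQuery of nat & nat & expr.

Record state := State {
  reg : nat -> nat;
  arr : nat -> nat -> nat
}.

Definition set_reg (s : state) (r v : nat) : state :=
  State (fun r' => if r' == r then v else reg s r') (arr s).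

Definition set_arr (s : state) (t i v : nat) : state :=
  State (reg s)
    (fun t' i' => if (t' == t) && (i' == i) then v else arr s t' i').

Fixpoint eval_expr (s : state) (e : expr) : nat :=
  match e with
  | ECst n => n
  | EReg r => reg s r
  | EGet t e1 => arr s t (eval_expr s e1)
  | EAdd e1 e2 => eval_expr s e1 + eval_expr s e2
  | ESub e1 e2 => eval_expr s e1 - eval_expr s e2
  | ELt e1 e2 => eval_expr s e1 < eval_expr s e2
  | EEq e1 e2 => eval_expr s e1 == eval_expr s e2
  end.

Fixpoint expr_cost (e : expr) : nat :=
  match e with
  | ECst _ | EReg _ => 1
  | EGet _ e1 => (expr_cost e1).+1
  | EAdd e1 e2 | ESub e1 e2 | ELt e1 e2 | EEq e1 e2 =>
      (expr_cost e1 + expr_cost e2).+1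
  end.

(* [exec oracle phi c s t s']: started in state [s], the command [c] halts in
   state [s'] after exactly [t] time units.  [CQuery r t e] submits the first
   [e] cells of array [t] to the oracle, stores the answer in register [r], and
   is charged [phi n] for a query of length [n]; writing the query into the
   array is paid for separately. *)
Inductive exec (oracle : seq nat -> bool) (phi : nat -> nat) :
    cmd -> state -> nat -> state -> Prop :=
| ExecSkip s :
    exec oracle phi CSkip s 1 s
| ExecSet r e s :
    exec oracle phi (CSet r e) s (expr_cost e).+1 (set_reg s r (eval_expr s e))
| ExecPut t e1 e2 s :
    exec oracle phi (CPut t e1 e2) s (expr_cost e1 + expr_cost e2).+1
      (set_arr s t (eval_expr s e1) (eval_expr s e2))
| ExecSeq c1 c2 s s1 s2 t1 t2 :
    exec oracle phi c1 s t1 s1 -> exec oracle phi c2 s1 t2 s2 ->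
    exec oracle phi (CSeq c1 c2) s (t1 + t2) s2
| ExecIfTrue e c1 c2 s t s' :
    eval_expr s e != 0 -> exec oracle phi c1 s t s' ->
    exec oracle phi (CIf e c1 c2) s (expr_cost e + t).+1 s'
| ExecIfFalse e c1 c2 s t s' :
    eval_expr s e = 0 -> exec oracle phi c2 s t s' ->
    exec oracle phi (CIf e c1 c2) s (expr_cost e + t).+1 s'
| ExecWhileTrue e c s s1 s2 t1 t2 :
    eval_expr s e != 0 ->
    exec oracle phi c s t1 s1 -> exec oracle phi (CWhile e c) s1 t2 s2 ->
    exec oracle phi (CWhile e c) s (expr_cost e + t1 + t2).+1 s2
| ExecWhileFalse e c s :
    eval_expr s e = 0 ->
    exec oracle phi (CWhile e c) s (expr_cost e).+1 s
| ExecQuery r t e s :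
    exec oracle phi (CQuery r t e) s
      (expr_cost e + phi (eval_expr s e)).+1
      (set_reg s r (oracle (mkseq (arr s t) (eval_expr s e)))).

Section Input.
Variables (k : nat) (G : graph).

(* The order of the arcs in the list of each vertex is arbitrary. *)
Definition adjacency_lists (adj : vertex G -> seq (arc_of G)) : Prop :=
  forall v, uniq (adj v) /\ forall x, (x \in adj v) = (arc_tail x == v).

Definition adjacency_entries (adj : vertex G -> seq (arc_of G)) : seq (arc_of G) :=
  flatten [seq adj v | v <- enum 'I_(nverts G)].

Definition adjacency_offsets (adj : vertex G -> seq (arc_of G)) : seq nat :=
  0 :: scanl addn 0 [seq size (adj v) | v <- enum 'I_(nverts G)].

(* The adjacency lists are stored consecutively: the list of vertex [v] occupies
   the positions [p] with
     [nth 0 (adjacency_offsets adj) v <= p < nth 0 (adjacency_offsets adj) v.+1],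
   and position [p] of arrays 1, 2 and 3 holds the code of its arc, the head of
   that arc and the label of that arc.  Array 3 is the concatenation of the label
   words; it is aligned with arrays 1 and 2 because it is only used for labels
   of length 1. *)
Definition input_state (adj : vertex G -> seq (arc_of G))
    (lab : arc_of G -> word k) (a b : vertex G) : state :=
  let entries := adjacency_entries adj in
  State
    (nth 0 [:: nverts G; nedges G; nat_of_ord a; nat_of_ord b])
    (fun t => nth 0 (nth [::]
       [:: adjacency_offsets adj;
           [seq arc_code x | x <- entries];
           [seq nat_of_ord (arc_head x) | x <- entries];
           flatten [seq [seq letter_code l | l <- lab x] | x <- entries]] t)).

End Input.

(* The trail is stored as arc codes in the first [nedges G] cells of array [t]. *)
Definition stores_trail (G : graph) (s : state) (t : nat) (p : seq (arc_of G))
  : Prop := mkseq (arr s t) (nedges G) = [seq arc_code x | x <- p].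

(* Main.v *)
Require Import Defs.
From HB Require Import structures.
From Stdlib Require Import Relations.
From mathcomp Require Import all_boot zify.

Set Implicit Arguments.
Unset Strict Implicit.
Unset Printing Implicit Defensive.

(* A trail [W] visits vertices at the times [0], ..., [n]; a chord is a pair of times at which
   it visits the same vertex, and it carries the label of the closed segment in between,
   conjugated by the label of the prefix.  Reversing closed segments connects all trails with
   the same ends and edges (Kotzig), and reversing a chord preserves the label of the trail
   exactly when the label of the chord is its own inverse.  Reversal of a chord [y] performs a
   local complementation on the graph of crossing chords and multiplies by the label of [y] the
   labels of the chords that cross [y].  Hence all Eulerian trails have the same label iff, for
   a single [W], any two chords at vertices linked by a chain of crossing chords have
   self-inverse labels that commute; it is enough to test this, by queries of length at most
   [8 m], for the chords from a time to a representative time of its vertex.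

   For the decision, [W] is found by Hierholzer's algorithm.  For the search, a prefix of [W]
   is extended arc by arc: among the possible next arcs, either one leads to a trail with
   another label, or one leaves a rest that still admits two labels. *)

(** * Crossing pairs of times *)

Section CrossingPairs.

Definition between (i1 i2 t : nat) : bool := (i1 < t) (+) (i2 < t).

Definition cross (i1 i2 j1 j2 : nat) : bool := between i1 i2 j1 (+) between i1 i2 j2.

Definition flip (r q t : nat) : nat := if r <= t <= q then r + q - t else t.

Lemma flipK r q : involutive (flip r q).
Proof.
move=> t; rewrite /flip; case: (boolP (r <= t <= q)) => tin; last by rewrite (negbTE tin).
by case: ifP => ?; lia.
Qed.

Lemma flip_in r q t : (r <= flip r q t <= q) = (r <= t <= q).
Proof. by rewrite /flip; case: ifP => // ?; lia. Qed.

Lemma flip_le r q n t : q <= n -> t <= n -> flip r q t <= n.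
Proof. by rewrite /flip; case: ifP => ?; lia. Qed.

Lemma ltn_flip r q i j : i != j ->
  (flip r q i < flip r q j) = (i < j) (+) ((r <= i <= q) && (r <= j <= q)).
Proof.
rewrite /flip; case: (boolP (r <= i <= q)) => ?; case: (boolP (r <= j <= q)) => ? ij /=;
by rewrite ?addbF //; lia.
Qed.

Lemma cross_flip r q i1 i2 j1 j2 :
  i1 != j1 -> i1 != j2 -> i2 != j1 -> i2 != j2 ->
  cross (flip r q i1) (flip r q i2) (flip r q j1) (flip r q j2) =
  cross i1 i2 j1 j2 (+)
  (((r <= i1 <= q) (+) (r <= i2 <= q)) && ((r <= j1 <= q) (+) (r <= j2 <= q))).
Proof.
move=> ? ? ? ?; rewrite /cross /between !ltn_flip //.
by do 4!case: (_ < _); do 4!case: (_ <= _ <= _).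
Qed.

Lemma crossC i1 i2 j1 j2 :
  i1 != j1 -> i1 != j2 -> i2 != j1 -> i2 != j2 ->
  cross i1 i2 j1 j2 = cross j1 j2 i1 i2.
Proof.
move=> ? ? ? ?; rewrite /cross /between.
have ltnC i j : i != j -> (j < i) = ~~ (i < j) by lia.
rewrite (ltnC i1 j1) // (ltnC i1 j2) // (ltnC i2 j1) // (ltnC i2 j2) //.
by do 4!case: (_ < _).
Qed.

Lemma cross_swapr i1 i2 j1 j2 : cross i1 i2 j2 j1 = cross i1 i2 j1 j2.
Proof. by rewrite /cross addbC. Qed.

Lemma cross_swapl i1 i2 j1 j2 : cross i2 i1 j1 j2 = cross i1 i2 j1 j2.
Proof. by rewrite /cross /between (addbC (i1 < j1)) (addbC (i1 < j2)). Qed.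

Lemma cross_transl i2 i1 i3 j1 j2 :
  cross i1 i3 j1 j2 = cross i1 i2 j1 j2 (+) cross i2 i3 j1 j2.
Proof. by rewrite /cross /between; do 6!case: (_ < _). Qed.

Lemma cross_transr j2 i1 i2 j1 j3 :
  cross i1 i2 j1 j3 = cross i1 i2 j1 j2 (+) cross i1 i2 j2 j3.
Proof. by rewrite /cross; do 3!case: (between _ _ _). Qed.

Lemma cross_in r q j1 j2 : r <= q ->
  r != j1 -> q != j1 -> r != j2 -> q != j2 ->
  cross r q j1 j2 = (r <= j1 <= q) (+) (r <= j2 <= q).
Proof.
have betweenE j : r <= q -> r != j -> q != j -> between r q j = (r <= j <= q).
  by rewrite /between => rq a b; case: ltngtP a => //; case: ltngtP b => //=; lia.
by move=> ? ? ? ? ?; rewrite /cross !betweenE.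
Qed.

Lemma separate_both (T : Type) (f g : T -> bool) (P : T -> Prop) a1 a2 b1 b2 :
  P a1 -> P a2 -> P b1 -> P b2 -> f a1 (+) f a2 -> g b1 (+) g b2 ->
  exists t1 t2, [/\ P t1, P t2, f t1 (+) f t2 & g t1 (+) g t2].
Proof.
move=> Pa1 Pa2 Pb1 Pb2 fa gb.
pose both t1 t2 := (f t1 (+) f t2) && (g t1 (+) g t2).
case: (boolP (both a1 a2)) => [/andP[]|not_a]; first by exists a1, a2.
case: (boolP (both b1 b2)) => [/andP[]|not_b]; first by exists b1, b2.
case: (boolP (both a1 b1)) => [/andP[]|not_11]; first by exists a1, b1.
case: (boolP (both a2 b1)) => [/andP[]|not_21]; first by exists a2, b1.
case: (boolP (both a1 b2)) => [/andP[]|not_12]; first by exists a1, b2.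
exists a2, b2; split=> //; move: fa gb not_a not_b not_11 not_21 not_12; rewrite /both;
by do 4!case: (f _); do 4!case: (g _).
Qed.

Lemma additive_detour (T : Type) (x : T -> T -> bool) (P : T -> Prop) a1 a2 i1 i2 :
  (forall b a c, x a c = x a b (+) x b c) -> P a1 -> P a2 -> x a1 a2 -> ~~ x i1 i2 ->
  exists2 a, P a & x i1 a /\ x a i2.
Proof.
move=> xD Pa1 Pa2 xa xi; case: (boolP (x i1 a1)) => y.
  by exists a1 => //; split=> //; move: xi; rewrite (xD a1) y; case: (x a1 i2).
exists a2 => //; have x1 : x i1 a2 by rewrite (xD a1) (negbTE y) xa.
by split=> //; move: xi; rewrite (xD a2) x1; case: (x a2 i2).
Qed.

End CrossingPairs.

(** * Self-inverse group elements *)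

Section SelfInverse.
Local Open Scope group_scope.
Variable Gamma : groupType.
Implicit Types (x y z : Gamma) (zs : seq Gamma).

Definition selfinv x : Prop := x^-1 = x.

Lemma selfinvP x : selfinv x <-> x * x = 1.
Proof. by split=> [xV|/mulg1_eq //]; rewrite -{1}xV mulVg. Qed.

Lemma selfinv_commute x y : selfinv x -> selfinv y -> selfinv (x * y) -> commute x y.
Proof. by move=> xV yV xyV; rewrite /commute -xyV invgM xV yV. Qed.

Lemma selfinvM x y : selfinv x -> selfinv y -> commute x y -> selfinv (x * y).
Proof. by move=> xV yV xy; rewrite /selfinv invgM xV yV. Qed.

Lemma selfinv_conj x z : selfinv (z * x * z^-1) <-> selfinv x.
Proof.
split=> inv; last by rewrite /selfinv !invgM invgK mulgA inv.
by apply: (mulgI z); apply: (mulIg z^-1); rewrite -[RHS]inv !invgM invgK mulgA.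
Qed.

Lemma commute_prodr z zs : {in zs, forall x, commute z x} -> commute z (\prod_(x <- zs) x).
Proof.
move=> zC; rewrite big_seq; elim/big_ind: _ => //; first exact: commute1.
by move=> ? ?; apply: commuteM.
Qed.

Lemma selfinv_prod zs : {in zs, forall x, selfinv x} -> {in zs &, forall x y, commute x y} ->
  selfinv (\prod_(x <- zs) x).
Proof.
elim: zs => [|z zs IH] inv comm; first by rewrite big_nil; apply: invg1.
have sub : {subset zs <= z :: zs} by move=> x xz; rewrite inE xz orbT.
rewrite big_cons; apply: selfinvM; first by apply: inv; rewrite inE eqxx.
- by apply: IH => [x /sub/inv //|x y /sub xz /sub yz]; apply: comm.
- by apply: commute_prodr => x xz; apply: comm; rewrite inE ?eqxx ?xz ?orbT.
Qed.

Lemma commute_cancel a b x z :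
  commute a z -> commute b z -> commute (a * x * b) z -> commute x z.
Proof.
move=> az bz axbz; have -> : x = a^-1 * (a * x * b) * b^-1 by rewrite -!mulgA mulgV mulg1 mulKg.
apply/commute_sym/commuteM; last exact/commuteV/commute_sym.
by apply: commuteM (commute_sym axbz); apply/commuteV/commute_sym.
Qed.

End SelfInverse.

(** * Linked vertices and reversals *)

Section TimeSequences.
Local Open Scope group_scope.
Variables (V : eqType) (Gamma : groupType) (n : nat).
Implicit Types (v : nat -> V) (p : nat -> Gamma) (u w : V).

(* [v] lists the vertices that a trail with [n] arcs visits at the times [0], ..., [n], and
   [p] the labels of its prefixes. *)
Definition visit v u (i : nat) : Prop := (i <= n)%N /\ v i = u.

Definition chord v u (i1 i2 : nat) : Prop := visit v u i1 /\ visit v u i2.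

Definition interlaced v u w : Prop :=
  u != w /\ exists i1 i2 j1 j2, [/\ chord v u i1 i2, chord v w j1 j2 & cross i1 i2 j1 j2].

Fixpoint chain v k u w : Prop :=
  if k is k'.+1 then exists2 u', interlaced v u u' & chain v k' u' w else u = w.

Definition linked v u w : Prop := exists k, chain v k u w.

Definition chord_label p (i j : nat) : Gamma := p j * (p i)^-1.

(* The labels of the chords at the vertices of a class of linked vertices generate an
   elementary abelian 2-group. *)
Definition elementary v p : Prop :=
  forall u w i1 i2 j1 j2, linked v u w -> chord v u i1 i2 -> chord v w j1 j2 ->
    selfinv (chord_label p i1 i2 * chord_label p j1 j2).

Definition twist p (r q t : nat) : Gamma := if (r <= t <= q)%N then chord_label p r q else 1.

Definition reversal (r q : nat) v p v' p' : Prop :=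
  [/\ (r <= q)%N, chord v (v r) r q, selfinv (chord_label p r q),
      forall t, (t <= n)%N -> v' t = v (flip r q t) &
      forall t, (t <= n)%N -> p' t = twist p r q t * p (flip r q t)].

Lemma chord_label_trans p j i k : chord_label p i k = chord_label p j k * chord_label p i j.
Proof. by rewrite /chord_label mulgA mulgVK. Qed.

Lemma chord_labelV p i j : (chord_label p i j)^-1 = chord_label p j i.
Proof. exact: invgF. Qed.

Lemma chord_label_id p i : chord_label p i i = 1.
Proof. exact: mulgV. Qed.

Lemma chord_neq v u w i1 i2 j1 j2 : chord v u i1 i2 -> chord v w j1 j2 -> u != w ->
  [/\ i1 != j1, i1 != j2, i2 != j1 & i2 != j2].
Proof.
move=> [[_ <-] [_ a]] [[_ <-] [_ b]] uw.
by split; apply: contraNneq uw => E; apply/eqP; congruence.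
Qed.

Lemma chord_crossC v u w i1 i2 j1 j2 : chord v u i1 i2 -> chord v w j1 j2 -> u != w ->
  cross i1 i2 j1 j2 = cross j1 j2 i1 i2.
Proof. by move=> c d uw; have [? ? ? ?] := chord_neq c d uw; apply: crossC. Qed.

Lemma chord_cross_in v u w r q j1 j2 : (r <= q)%N -> chord v u r q -> chord v w j1 j2 -> u != w ->
  cross r q j1 j2 = (r <= j1 <= q)%N (+) (r <= j2 <= q)%N.
Proof. by move=> rq c d uw; have [? ? ? ?] := chord_neq c d uw; apply: cross_in. Qed.

Lemma chord_cross_flip v u w r q i1 i2 j1 j2 : chord v u i1 i2 -> chord v w j1 j2 -> u != w ->
  cross (flip r q i1) (flip r q i2) (flip r q j1) (flip r q j2) =
  cross i1 i2 j1 j2 (+) (((r <= i1 <= q)%N (+) (r <= i2 <= q)%N) &&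
                         ((r <= j1 <= q)%N (+) (r <= j2 <= q)%N)).
Proof. by move=> c d uw; have [? ? ? ?] := chord_neq c d uw; apply: cross_flip. Qed.

Lemma chord_sym v u i1 i2 : chord v u i1 i2 -> chord v u i2 i1.
Proof. by case. Qed.

Lemma interlaced_sym v u w : interlaced v u w -> interlaced v w u.
Proof.
move=> [uw [i1 [i2 [j1 [j2 [c d x]]]]]]; split; first by rewrite eq_sym.
by exists j1, j2, i1, i2; split; rewrite // -(chord_crossC c d uw).
Qed.

Lemma chain_cat v k l u w z : chain v k u w -> chain v l w z -> chain v (k + l) u z.
Proof.
elim: k u => [|k IH] u /=; first by move=> ->.
by case=> u' uu' u'w wz; exists u'; last exact: IH wz.
Qed.

Lemma linked_refl v u : linked v u u.
Proof. by exists 0. Qed.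

Lemma linked_trans v w u z : linked v u w -> linked v w z -> linked v u z.
Proof. by move=> [k uw] [l wz]; exists (k + l)%N; apply: chain_cat uw wz. Qed.

Lemma interlaced_linked v u w : interlaced v u w -> linked v u w.
Proof. by move=> uw; exists 1%N, w. Qed.

Lemma linked_sym v u w : linked v u w -> linked v w u.
Proof.
move=> [k]; elim: k u => [|k IH] u /=; first by move=> ->; apply: linked_refl.
by case=> u' uu' /IH wu'; apply: linked_trans wu' (interlaced_linked (interlaced_sym uu')).
Qed.

Definition near v u w : Prop := u = w \/ interlaced v u w.

Lemma near_linked v u w : near v u w -> linked v u w.
Proof. by case=> [->|/interlaced_linked //]; apply: linked_refl. Qed.

Definition class_label v p u z : Prop :=
  exists u' i j, [/\ linked v u u', chord v u' i j & z = chord_label p i j].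

Lemma class_labelV v p u z : class_label v p u z -> class_label v p u z^-1.
Proof.
by move=> [u' [i [j [l c ->]]]]; exists u', j, i; split; rewrite ?chord_labelV //; apply: chord_sym.
Qed.

Lemma elementary_selfinv v p u i j : elementary v p -> chord v u i j -> selfinv (chord_label p i j).
Proof.
move=> el c; rewrite -[chord_label p i j]mulg1 -(chord_label_id p i).
by have [ci cj] := c; apply: (el _ _ _ _ _ _ (linked_refl v u) c).
Qed.

Lemma elementary_prod v p u zs : elementary v p -> {in zs, forall z, class_label v p u z} ->
  selfinv (\prod_(z <- zs) z).
Proof.
move=> el cl; have inv z : z \in zs -> selfinv z.
  by move=> /cl[u' [i [j [_ c ->]]]]; apply: elementary_selfinv el c.
apply: selfinv_prod => // y z yzs zzs; apply: selfinv_commute; do ?exact: inv.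
have [u1 [i1 [i2 [l1 c1 ->]]]] := cl y yzs; have [u2 [j1 [j2 [l2 c2 ->]]]] := cl z zzs.
exact: el (linked_trans (linked_sym l1) l2) c1 c2.
Qed.

Lemma chord_crossing_both v u w x1 x2 a1 a2 b1 b2 j1 j2 : u != w ->
  chord v u a1 a2 -> chord v u b1 b2 -> chord v w j1 j2 ->
  cross x1 x2 a1 a2 -> cross b1 b2 j1 j2 ->
  exists r q, [/\ (r <= q)%N, chord v u r q, cross x1 x2 r q & cross j1 j2 r q].
Proof.
move=> uw [va1 va2] cb d xa; rewrite (chord_crossC cb d uw) => yb.
have [r [q [vr vq xr yr]]] := separate_both va1 va2 cb.1 cb.2 xa yb.
have [rq|/ltnW qr] := leqP r q; first by exists r, q.
by exists q, r; rewrite cross_swapr (cross_swapr j1).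
Qed.

Section Reversal.
Variables (r q : nat) (v : nat -> V) (p : nat -> Gamma) (v' : nat -> V) (p' : nat -> Gamma).
Hypothesis revP : reversal r q v p v' p'.

Local Notation inside t := (r <= t <= q)%N.

Lemma near_reversed u i1 i2 : chord v u i1 i2 -> inside i1 (+) inside i2 -> near v u (v r).
Proof.
case: revP => rq cr _ _ _ c x; have [->|ne] := eqVneq u (v r); [by left | right].
apply: interlaced_sym; split; first by rewrite eq_sym.
by exists r, q, i1, i2; split; rewrite // (chord_cross_in rq cr c) // eq_sym.
Qed.

Lemma chord_flip u i1 i2 : chord v' u i1 i2 -> chord v u (flip r q i1) (flip r q i2).
Proof.
case: revP => _ [_ [qn _]] _ vE _ [[a <-] [b E]].
by split; split; rewrite ?flip_le // -?vE.
Qed.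

Lemma chord_unflip u i1 i2 : chord v u i1 i2 -> chord v' u (flip r q i1) (flip r q i2).
Proof.
case: revP => _ [_ [qn _]] _ vE _ [[a <-] [b E]].
by split; split; rewrite ?flip_le // vE ?flipK ?flip_le.
Qed.

Lemma chord_label_reversal i1 i2 : (i1 <= n)%N -> (i2 <= n)%N ->
  chord_label p' i1 i2 =
  twist p r q i2 * chord_label p (flip r q i1) (flip r q i2) * (twist p r q i1)^-1.
Proof.
case: revP => _ _ _ _ pE i1n i2n.
by rewrite {1}/chord_label !pE // invgM /chord_label !mulgA.
Qed.

Lemma interlaced_reversal u w : interlaced v' u w ->
  interlaced v u w \/ near v u (v r) /\ near v w (v r).
Proof.
move=> [uw [i1 [i2 [j1 [j2 [/chord_flip c /chord_flip d x]]]]]].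
have := chord_cross_flip r q c d uw; rewrite !flipK x => /esym crossE.
case: (boolP (_ && _)) crossE => [/andP[exit_u exit_w] _|_]; last rewrite addbF => crossE.
  by right; split; [apply: near_reversed exit_u | apply: near_reversed exit_w].
by left; split=> //; exists (flip r q i1), (flip r q i2), (flip r q j1), (flip r q j2).
Qed.

Lemma linked_reversal u w : linked v' u w -> linked v u w.
Proof.
move=> [k]; elim: k u => [|k IH] u /=; first by move=> ->; apply: linked_refl.
case=> u' /interlaced_reversal uu' /IH; apply: linked_trans.
case: uu' => [/interlaced_linked //|[/near_linked ur /near_linked/linked_sym]].
exact: linked_trans.
Qed.

(* A class of linked vertices lies on one side of the reversed segment, unless it
   contains the end vertex of that segment. *)
Lemma linked_across u w i j : linked v u w -> visit v u i -> visit v w j ->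
  inside i (+) inside j -> linked v u (v r).
Proof.
move=> [k]; elim: k u i => [|k IH] u i /=.
  by move=> <- vi vj x; apply/near_linked/(near_reversed (conj vi vj)).
move=> [u' uu' ch] vi vj x; have lk := interlaced_linked uu'.
have [_ [i1 [i2 [j1 [j2 [[vi1 vi2] [vj1 vj2] cr]]]]]] := uu'.
have leave i' : visit v u i' -> inside i (+) inside i' -> linked v u (v r).
  by move=> vi' exit; apply/near_linked/(near_reversed (conj vi vi')).
case: (boolP (inside i (+) inside i1)) => [/(leave _ vi1) //|same_i1].
case: (boolP (inside i (+) inside i2)) => [/(leave _ vi2) //|same_i2].
case: (boolP (inside j1 (+) inside j2)) => [exit|same_j12].
  by apply: linked_trans lk _; apply/near_linked/(near_reversed (conj vj1 vj2)).
case: (boolP (inside j1 (+) inside j)) => [exit|same_j].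
  by apply: linked_trans lk _; apply: IH vj1 vj exit.
by exfalso; move: cr; rewrite /cross /between; case: revP => rq _ _ _ _; lia.
Qed.

Lemma twist_class_label u t : linked v u (v r) -> class_label v p u (twist p r q t).
Proof.
have [_ cr _ _ _] := revP; move=> ur; exists (v r); rewrite /twist.
case: ifP => _; first by exists r, q.
by exists r, r; rewrite chord_label_id; case: cr.
Qed.

Lemma elementary_linked_reversal u w i1 i2 j1 j2 : elementary v p ->
  linked v u (v r) -> linked v w (v r) -> chord v' u i1 i2 -> chord v' w j1 j2 ->
  selfinv (chord_label p' i1 i2 * chord_label p' j1 j2).
Proof.
move=> el ur wr c d; have [[[i1n _] [i2n _]] [[j1n _] [j2n _]]] := (c, d).
have twistP t := twist_class_label t (linked_refl v (v r)).
have flipP u' k l : linked v u' (v r) -> chord v' u' k l ->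
    class_label v p (v r) (chord_label p (flip r q k) (flip r q l)).
  move=> u'r /chord_flip ckl; exists u', (flip r q k), (flip r q l).
  by split=> //; apply: linked_sym.
rewrite !chord_label_reversal //; set g := chord_label p _ _; set h := chord_label p _ _.
have -> : twist p r q i2 * g * (twist p r q i1)^-1 *
      (twist p r q j2 * h * (twist p r q j1)^-1) =
    \prod_(z <- [:: twist p r q i2; g; (twist p r q i1)^-1;
                    twist p r q j2; h; (twist p r q j1)^-1]) z.
  by rewrite !big_cons big_nil mulg1 !mulgA.
apply: (elementary_prod (u := v r) el) => z; rewrite !inE.
do 5?case/predU1P=> [->|]; last move/eqP->; rewrite ?/g ?/h //.
- exact: flipP ur c.
- exact: class_labelV.
- exact: flipP wr d.
- exact: class_labelV.
Qed.

Lemma elementary_reversal : elementary v p -> elementary v' p'.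
Proof.
move=> el u w i1 i2 j1 j2 /linked_reversal uw c d.
have linkedP : linked v u (v r) -> selfinv (chord_label p' i1 i2 * chord_label p' j1 j2).
  by move=> ur; apply: elementary_linked_reversal el ur (linked_trans (linked_sym uw) ur) c d.
have c' := chord_flip c; have d' := chord_flip d.
case: (boolP (inside i1 (+) inside i2)) => side_i.
  by apply/linkedP/near_linked/(near_reversed c'); rewrite !flip_in.
case: (boolP (inside j1 (+) inside j2)) => side_j.
  apply/linkedP/(linked_trans uw)/near_linked/(near_reversed d').
  by rewrite !flip_in.
case: (boolP (inside i1 (+) inside j1)) => side_ij.
  by apply/linkedP/(linked_across uw c'.1 d'.1); rewrite !flip_in.
have twistE t : inside t = inside i1 -> twist p r q t = twist p r q i1 by rewrite /twist => ->.
have [[[i1n _] [i2n _]] [[j1n _] [j2n _]]] := (c, d).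
rewrite !chord_label_reversal // (twistE i2) ?(twistE j2) ?(twistE j1); last 3 first.
- by move: side_ij; case: (inside i1); case: (inside j1).
- by move: side_ij side_j; case: (inside i1); case: (inside j1); case: (inside j2).
- by move: side_i; case: (inside i1); case: (inside i2).
set t := twist p r q i1; set g := chord_label p _ _; set h := chord_label p _ _.
have -> : t * g * t^-1 * (t * h * t^-1) = t * (g * h) * t^-1 by rewrite !mulgA mulgVK.
exact/selfinv_conj/(el _ _ _ _ _ _ uw).
Qed.

Lemma chain_reversal_or_shorter k u w : chain v k u w ->
  chain v' k u w \/ exists2 l, (l <= k)%N & chain v l (v r) w.
Proof.
elim: k u => [|k IH] u /=; first by left.
case=> u' [uu' [i1 [i2 [j1 [j2 [c d x]]]]]] ch; have := chord_cross_flip r q c d uu'.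
case: (boolP (_ && _)) => [/andP[_ /(near_reversed d)] [E|/interlaced_sym ru'] _|_].
- by right; exists k => //; rewrite -E.
- by right; exists k.+1 => //; exists u'.
rewrite x addbF => xflip; case: (IH _ ch) => [ch'|[l lk cl]]; last first.
  by right; exists l => //; apply: leqW.
left; exists u' => //; split=> //.
exists (flip r q i1), (flip r q i2), (flip r q j1), (flip r q j2).
by split=> //; apply: chord_unflip.
Qed.

Lemma interlaced_after_reversal u w i1 i2 j1 j2 : u != w -> u != v r -> w != v r ->
  chord v u i1 i2 -> chord v w j1 j2 -> cross i1 i2 r q -> cross j1 j2 r q ->
  ~~ cross i1 i2 j1 j2 -> interlaced v' u w.
Proof.
move=> uw ur wr c d xr yr xy; have [rq cr _ _ _] := revP; split=> //.
exists (flip r q i1), (flip r q i2), (flip r q j1), (flip r q j2).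
split; do ?exact: chord_unflip.
rewrite (chord_crossC c cr ur) in xr; rewrite (chord_crossC d cr wr) in yr.
rewrite (chord_cross_flip r q c d uw) (negbTE xy).
by rewrite -(chord_cross_in rq cr c) 1?eq_sym // -(chord_cross_in rq cr d) 1?eq_sym // xr yr.
Qed.

Lemma commute_before_reversal u w i1 i2 j1 j2 :
  chord v u i1 i2 -> chord v w j1 j2 ->
  commute (chord_label p i1 i2) (chord_label p r q) ->
  commute (chord_label p j1 j2) (chord_label p r q) ->
  commute (chord_label p' (flip r q i1) (flip r q i2))
          (chord_label p' (flip r q j1) (flip r q j2)) ->
  commute (chord_label p i1 i2) (chord_label p j1 j2).
Proof.
move=> c d cy dy.
have [[i1n _] [i2n _]] := chord_unflip c; have [[j1n _] [j2n _]] := chord_unflip d.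
rewrite !chord_label_reversal // !flipK; set t := twist p r q.
have tC z k : commute z (chord_label p r q) -> commute (t k) z.
  by rewrite /t /twist; case: ifP => _ zy; apply: commute_sym => //; apply: commute1.
have tVC z k : commute z (chord_label p r q) -> commute (t k)^-1 z.
  by move=> zy; apply/commute_sym/commuteV/commute_sym/tC.
have tt k l : commute (t k) (t l) by exact: tC _ _ (tC _ _ erefl).
have tX k : commute (t k) (t (flip r q i2) * chord_label p i1 i2 * (t (flip r q i1))^-1).
  by apply: commuteM; [apply: commuteM => //; apply: tC | apply: commuteV].
move=> comm; apply: (commute_cancel (tC _ (flip r q i2) dy) (tVC _ (flip r q i1) dy)).
apply/commute_sym/(commute_cancel (tX _) _ (commute_sym comm)).
exact/commute_sym/commuteV/commute_sym/tX.
Qed.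

End Reversal.

Section Representatives.
Variables (v : nat -> V) (p : nat -> Gamma) (rep : V -> nat).
Hypothesis visit_rep : forall u i, visit v u i -> visit v u (rep u).

Lemma interlacedP u w : interlaced v u w <-> u != w /\
  exists i j, [/\ visit v u i, visit v w j & cross (rep u) i (rep w) j].
Proof.
split=> [[uw [i1 [i2 [j1 [j2 [[vi1 vi2] [vj1 vj2] x]]]]]]|[uw [i [j [vi vj x]]]]]; split=> //.
  have [i vi xi] : exists2 i, visit v u i & cross (rep u) i j1 j2.
    move: x; rewrite (cross_transl (rep u)) cross_swapl.
    by case: (boolP (cross _ i1 _ _)) => [? _|_ ?]; [exists i1 | exists i2].
  have [j vj xj] : exists2 j, visit v w j & cross (rep u) i (rep w) j.
    move: xi; rewrite (cross_transr (rep w)) cross_swapr.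
    by case: (boolP (cross _ _ _ j1)) => [? _|_ ?]; [exists j1 | exists j2].
  by exists i, j.
by exists (rep u), i, (rep w), j; split=> //; split=> //; apply: visit_rep; [apply: vi | apply: vj].
Qed.

Lemma elementaryP : elementary v p <->
  forall u w i j, linked v u w -> visit v u i -> visit v w j ->
    selfinv (chord_label p (rep u) i * chord_label p (rep w) j).
Proof.
split=> [el u w i j uw vi vj|rep_inv].
  by apply: el uw _ _; split=> //; apply: visit_rep; [apply: vi | apply: vj].
have inv u i : visit v u i -> selfinv (chord_label p (rep u) i).
  move=> vi; have := rep_inv u u i _ (linked_refl v u) vi (visit_rep vi).
  by rewrite chord_label_id mulg1.
have repE u i1 i2 : chord v u i1 i2 ->
    chord_label p i1 i2 = chord_label p (rep u) i2 * chord_label p (rep u) i1.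
  by move=> [vi1 _]; rewrite (chord_label_trans p (rep u)) -(chord_labelV p (rep u)) inv.
move=> u w i1 i2 j1 j2 uw c d; rewrite (repE u i1 i2) // (repE w j1 j2) //.
pose label (k : V * nat) := chord_label p (rep k.1) k.2.
suff : selfinv (\prod_(z <- [seq label k | k <- [:: (u, i2); (u, i1); (w, j2); (w, j1)]]) z).
  by rewrite !big_cons big_nil mulg1 !mulgA.
have inClass k : k \in [:: (u, i2); (u, i1); (w, j2); (w, j1)] ->
    visit v k.1 k.2 /\ linked v u k.1.
  have [[[vi1 vi2] [vj1 vj2]] uu] := ((c, d), linked_refl v u).
  by rewrite !inE; do 3?case/predU1P=> [->//|]; move/eqP->.
apply: selfinv_prod => [_ /mapP[k /inClass[vk _] ->]|]; first exact: inv.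
move=> _ _ /mapP[k /inClass[vk uk] ->] /mapP[l /inClass[vl ul] ->].
apply: selfinv_commute; do ?[exact: inv]; apply: rep_inv => //.
exact: linked_trans (linked_sym uk) ul.
Qed.

End Representatives.

Section UniformFamily.
Variable family : (nat -> V) -> (nat -> Gamma) -> Prop.
Hypothesis family_selfinv : forall v p u r q, family v p -> chord v u r q -> (r <= q)%N ->
  selfinv (chord_label p r q).
Hypothesis family_reversal : forall v p u r q, family v p -> chord v u r q -> (r <= q)%N ->
  exists v' p', family v' p' /\ reversal r q v p v' p'.

Lemma chord_selfinv v p u i1 i2 : family v p -> chord v u i1 i2 -> selfinv (chord_label p i1 i2).
Proof.
move=> Fv c; have [le12|/ltnW le21] := leqP i1 i2; first exact: family_selfinv Fv c le12.
rewrite -chord_labelV; have inv := family_selfinv Fv (chord_sym c) le21.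
by rewrite /selfinv !inv.
Qed.

Lemma commute_chords_at v p u i1 i2 j1 j2 : family v p -> chord v u i1 i2 -> chord v u j1 j2 ->
  commute (chord_label p i1 i2) (chord_label p j1 j2).
Proof.
move=> Fv c d; have inv i j : visit v u i -> visit v u j -> selfinv (chord_label p i j).
  by move=> vi vj; apply: chord_selfinv Fv (conj vi vj).
have comm j : visit v u j -> commute (chord_label p i1 i2) (chord_label p i1 j).
  case: c => vi1 vi2 vj; apply: selfinv_commute; do ?exact: inv.
  by rewrite -(inv i1 j) // chord_labelV -chord_label_trans; apply: inv.
rewrite (chord_label_trans p i1 j1); apply: commuteM; first by case: d => _ /comm.
by rewrite -(chord_labelV p i1 j1); apply: commuteV; case: d => /comm.
Qed.

(* Reversing one of two crossing chords multiplies the label of the other by its label; that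
   the three labels are self-inverse means that the first two commute. *)
Lemma commute_crossing v p u w i1 i2 j1 j2 : family v p -> u != w ->
  chord v u i1 i2 -> chord v w j1 j2 -> cross i1 i2 j1 j2 ->
  commute (chord_label p i1 i2) (chord_label p j1 j2).
Proof.
move=> Fv uw; wlog le_i : i1 i2 / (i1 <= i2)%N => [wl|] c d x.
  have [|/ltnW] := leqP i1 i2; first by move/wl; apply.
  rewrite -chord_labelV -(cross_swapl i1) in x *; move=> /wl comm.
  by apply/commute_sym/commuteV/commute_sym/comm => //; apply: chord_sym.
have [v' [p' [Fv' revP]]] := family_reversal Fv c le_i.
have d' := chord_unflip revP d; have [[j1n _] [j2n _]] := d'.
have := chord_selfinv Fv' d'; rewrite (chord_label_reversal revP) // !flipK /twist !flip_in.
have inv_c := chord_selfinv Fv c; have inv_d := chord_selfinv Fv d.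
move: x; rewrite (chord_cross_in le_i c d uw).
case: (i1 <= j1 <= i2)%N; case: (i1 <= j2 <= i2)%N => //= _.
  by rewrite mul1g inv_c => /(selfinv_commute inv_d inv_c)/commute_sym.
by rewrite invg1 mulg1 => /(selfinv_commute inv_c inv_d).
Qed.

Lemma commute_interlaced v p u w i1 i2 j1 j2 : family v p -> interlaced v u w ->
  chord v u i1 i2 -> chord v w j1 j2 -> commute (chord_label p i1 i2) (chord_label p j1 j2).
Proof.
move=> Fv [uw [a1 [a2 [b1 [b2 [[va1 va2] [vb1 vb2] xab]]]]]] [vi1 vi2] [vj1 vj2].
have comm_cross d1 d2 : chord v w d1 d2 -> cross a1 a2 d1 d2 ->
    commute (chord_label p i1 i2) (chord_label p d1 d2).
  move=> cd xd; have comm k l := @commute_crossing v p u w k l d1 d2 Fv uw.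
  case: (boolP (cross i1 i2 d1 d2)) => x; first by apply: comm.
  have [//|a va [x1 x2]] := additive_detour (x := fun k l => cross k l d1 d2) _ va1 va2 xd x.
    by move=> ? ? ?; apply: cross_transl.
  rewrite (chord_label_trans p a i1); apply/commute_sym.
  by apply: commuteM; apply/commute_sym/comm.
case: (boolP (cross a1 a2 j1 j2)) => x; first exact: comm_cross.
have [//|b vb [x1 x2]] := additive_detour (x := fun k l => cross a1 a2 k l) _ vb1 vb2 xab x.
  by move=> ? ? ?; apply: cross_transr.
by rewrite (chord_label_trans p b j1); apply: commuteM; apply: comm_cross.
Qed.

(* Reversing a chord at [u1] that crosses a chord at [u] and one at [u2] makes [u] and [u2]
   interlaced, which shortens the chain [u], [u1], [u2], ..., [w]. *)
Lemma commute_chain k v p u w i1 i2 j1 j2 : family v p -> chain v k u w ->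
  chord v u i1 i2 -> chord v w j1 j2 -> commute (chord_label p i1 i2) (chord_label p j1 j2).
Proof.
elim/ltn_ind: k => -[|[|k]] IH in v p u w i1 i2 j1 j2 * => Fv /=.
- by move=> ->; apply: commute_chords_at.
- by move=> [u' uu' <-]; apply: commute_interlaced.
move=> [u1 uu1 [u2 u12 ch]] c d.
have [E|u02] := eqVneq u u2; first by apply: (IH k _ v p u w) => //; rewrite E.
have [u_u1 [x1 [x2 [a1 [a2 [cx ca xa]]]]]] := uu1.
have [u1_u2 [b1 [b2 [z1 [z2 [cb cz bz]]]]]] := u12.
case: (boolP (cross x1 x2 z1 z2)) => xz.
  by apply: (IH k.+1 _ v p u w) => //; exists u2 => //; split=> //; exists x1, x2, z1, z2.
have [r [q [rq cr xr zr]]] := chord_crossing_both u1_u2 ca cb cz xa bz.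
have [v' [p' [Fv' revP]]] := family_reversal Fv cr rq.
have vr : v r = u1 by case: cr => -[].
case: (chain_reversal_or_shorter revP ch) => [ch'|[l lk]]; last first.
  by rewrite vr => cl; apply: (IH l.+1 _ v p u w) => //; exists u1.
apply: (commute_before_reversal revP c d).
- exact: commute_interlaced Fv uu1 c cr.
- by apply/commute_sym/(IH k.+1 _ v p u1 w) => //; exists u2.
have c' := chord_unflip revP c; have d' := chord_unflip revP d.
apply: (IH k.+1 _ v' p' u w) => //; exists u2 => //.
by apply: (interlaced_after_reversal revP u02 _ _ cx cz xr zr xz); rewrite vr // eq_sym.
Qed.

Lemma uniform_elementary v p : family v p -> elementary v p.
Proof.
move=> Fv u w i1 i2 j1 j2 [k ch] c d.
apply: selfinvM; [exact: chord_selfinv Fv c | exact: chord_selfinv Fv d |].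
exact: commute_chain Fv ch c d.
Qed.

End UniformFamily.

End TimeSequences.

(** * Reversals connect the trails with given ends and edges *)

Section Walks.
Variable G : graph.
Implicit Types (a b c : vertex G) (x y f : arc_of G) (s S T P Q R : seq (arc_of G)).

Definition edges_of s : seq (edge G) := [seq arc_edge x | x <- s].

Definition end_vertex a s : vertex G := last a [seq arc_head x | x <- s].

Definition rev_walk s : seq (arc_of G) := rev [seq arc_inv x | x <- s].

Definition rev_step a s s' : Prop := exists P Q R,
  [/\ s = P ++ Q ++ R, s' = P ++ rev_walk Q ++ R & end_vertex a P = end_vertex a (P ++ Q)].

Definition rev_steps a : relation (seq (arc_of G)) := clos_refl_trans _ (rev_step a).

Definition passes a s c : Prop := exists s1 s2, s = s1 ++ s2 /\ end_vertex a s1 = c.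

Lemma arc_invK : involutive (@arc_inv G).
Proof. by case=> e o; rewrite /arc_inv negbK. Qed.

Lemma arc_tail_inv x : arc_tail (arc_inv x) = arc_head x.
Proof. by case: x => e []. Qed.

Lemma arc_head_inv x : arc_head (arc_inv x) = arc_tail x.
Proof. by case: x => e []. Qed.

Lemma eq_arc_edge x y : arc_edge x = arc_edge y -> x = y \/ x = arc_inv y.
Proof.
case: x => e o; case: y => e' o'; rewrite /arc_edge /arc_inv /= => ->.
by case: o; case: o'; [left|right|right|left].
Qed.

Lemma end_vertex_cat a s1 s2 : end_vertex a (s1 ++ s2) = end_vertex (end_vertex a s1) s2.
Proof. by rewrite /end_vertex map_cat last_cat. Qed.

Lemma end_vertex_rcons a s x : end_vertex a (rcons s x) = arc_head x.
Proof. by rewrite /end_vertex map_rcons last_rcons. Qed.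

Lemma walk_end a b s : walk a b s -> end_vertex a s = b.
Proof. by elim: s a => [|x s IH] a /= => [/eqP|/andP[_ /IH]]. Qed.

Lemma walk_cat a b s1 s2 :
  walk a b (s1 ++ s2) = walk a (end_vertex a s1) s1 && walk (end_vertex a s1) b s2.
Proof. by elim: s1 a => [|x s IH] a /=; rewrite ?eqxx //= IH andbA. Qed.

Lemma walk_rcons a b s x :
  walk a b (rcons s x) = walk a (arc_tail x) s && (arc_head x == b).
Proof. by elim: s a => [|y s IH] a /=; rewrite ?IH ?andbA // eq_sym. Qed.

Lemma rev_walk_cons x s : rev_walk (x :: s) = rcons (rev_walk s) (arc_inv x).
Proof. by rewrite /rev_walk /= rev_cons. Qed.

Lemma rev_walk_rcons s x : rev_walk (rcons s x) = arc_inv x :: rev_walk s.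
Proof. by rewrite /rev_walk map_rcons rev_rcons. Qed.

Lemma rev_walk_cat s1 s2 : rev_walk (s1 ++ s2) = rev_walk s2 ++ rev_walk s1.
Proof. by rewrite /rev_walk map_cat rev_cat. Qed.

Lemma rev_walkK : involutive rev_walk.
Proof. by move=> s; rewrite /rev_walk map_rev revK mapK //; apply: arc_invK. Qed.

Lemma size_rev_walk s : size (rev_walk s) = size s.
Proof. by rewrite size_rev size_map. Qed.

Lemma walk_rev a b s : walk a b s -> walk b a (rev_walk s).
Proof.
elim: s a => [|x s IH] a /=; first by rewrite eq_sym.
case/andP=> /eqP ha /IH ws.
by rewrite rev_walk_cons walk_rcons arc_tail_inv arc_head_inv ha eqxx andbT.
Qed.

Lemma edges_rev_walk s : edges_of (rev_walk s) = rev (edges_of s).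
Proof. by rewrite /edges_of /rev_walk map_rev -map_comp. Qed.

Lemma edges_of_cat s1 s2 : edges_of (s1 ++ s2) = edges_of s1 ++ edges_of s2.
Proof. exact: map_cat. Qed.

Lemma rev_step_edges a s s' : rev_step a s s' -> perm_eq (edges_of s) (edges_of s').
Proof.
move=> [P [Q [R [-> -> _]]]]; rewrite !edges_of_cat edges_rev_walk.
by rewrite perm_cat2l perm_cat2r perm_sym perm_rev.
Qed.

Lemma rev_step_walk a b s s' : rev_step a s s' -> walk a b s -> walk a b s'.
Proof.
move=> [P [Q [R [-> -> E]]]]; rewrite !walk_cat -end_vertex_cat -E => /and3P[-> wQ wR].
by have wQ' := walk_rev wQ; rewrite (walk_end wQ') wQ' wR.
Qed.

Lemma rev_steps_edges a s s' : rev_steps a s s' -> perm_eq (edges_of s) (edges_of s').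
Proof.
elim=> {s s'} [s s'|//|s1 s2 s3 _ p12 _ p23]; first exact: rev_step_edges.
exact: perm_trans p12 p23.
Qed.

Lemma rev_steps_walk a b s s' : rev_steps a s s' -> walk a b s -> walk a b s'.
Proof.
elim=> {s s'} [s s'|//|s1 s2 s3 _ w12 _ w23 /w12/w23 //]; exact: rev_step_walk.
Qed.

Lemma rev_steps_cons a f s s' : rev_steps (arc_head f) s s' -> rev_steps a (f :: s) (f :: s').
Proof.
elim=> {s s'} [_ _ [P [Q [R [-> -> E]]]]|s|s1 s2 s3 _ st12 _ st23].
- by apply: rt_step; exists (f :: P), Q, R.
- exact: rt_refl.
- exact: rt_trans st12 st23.
Qed.

Lemma passes_ends a b s y : walk a b s -> arc_edge y \in edges_of s ->
  passes a s (arc_tail y) /\ passes a s (arc_head y).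
Proof.
move=> w /mapP[x /splitPr xs E]; case: xs w => s1 s2.
rewrite walk_cat /= => /and3P[_ /eqP hx _].
have vt : passes a (s1 ++ x :: s2) (arc_tail x) by exists s1, (x :: s2).
have vh : passes a (s1 ++ x :: s2) (arc_head x).
  by exists (rcons s1 x), s2; rewrite cat_rcons end_vertex_rcons.
by case: (eq_arc_edge E) => ->; rewrite ?arc_tail_inv ?arc_head_inv.
Qed.

Lemma shared_vertex a0 b0 c0 d0 S R T c b :
  walk a0 b0 S -> walk c0 d0 R -> passes c0 R c -> walk c b T ->
  {subset edges_of T <= edges_of S ++ edges_of R} ->
  has (fun e => e \in edges_of S) (edges_of T) ->
  exists u, passes a0 S u /\ passes c0 R u.
Proof.
move=> wS wR; elim: T c => [|y T IH] c //= vc /andP[/eqP tc wT] sub.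
case: (boolP (arc_edge y \in edges_of S)) => [yS _|nyS /= hasS].
  by exists c; split=> //; rewrite -tc; case: (passes_ends wS yS).
have yR : arc_edge y \in edges_of R.
  by have := sub (arc_edge y); rewrite mem_cat (negbTE nyS); apply; rewrite inE eqxx.
apply: (IH (arc_head y)) => //; first by case: (passes_ends wR yR).
by move=> e he; apply: sub; rewrite inE he orbT.
Qed.

Lemma rev_step_inverse_first a f S R : arc_tail f = a ->
  rev_step a (S ++ arc_inv f :: R) (f :: rev_walk S ++ R).
Proof.
move=> fa; exists [::], (rcons S (arc_inv f)), R; split.
- by rewrite /= cat_rcons.
- by rewrite rev_walk_rcons arc_invK.
- by rewrite /= end_vertex_rcons arc_head_inv.
Qed.

(* Reversing the closed segment from [u] to [u] turns [f] round; then [f] is brought to the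
   front by a second reversal. *)
Lemma rev_steps_first a f S1 S2 R1 R2 : arc_tail f = a ->
  end_vertex a S1 = end_vertex (arc_head f) R1 ->
  rev_steps a ((S1 ++ S2) ++ f :: R1 ++ R2) (f :: R1 ++ rev_walk S1 ++ rev_walk S2 ++ R2).
Proof.
move=> fa u; apply: (rt_trans _ _ _ (S1 ++ rev_walk (S2 ++ f :: R1) ++ R2)); apply: rt_step.
  exists S1, (S2 ++ f :: R1), R2; split; rewrite -?catA ?cat_cons //.
  by rewrite !end_vertex_cat u.
rewrite rev_walk_cat rev_walk_cons cat_rcons.
have := rev_step_inverse_first (S1 ++ rev_walk R1) (rev_walk S2 ++ R2) fa.
by rewrite rev_walk_cat rev_walkK -!catA cat_cons.
Qed.

Lemma kotzig_first a b s f T : walk a b s -> walk a b (f :: T) -> uniq (edges_of (f :: T)) ->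
  perm_eq (edges_of s) (edges_of (f :: T)) -> exists s', rev_steps a s (f :: s').
Proof.
move=> ws /andP[/eqP fa wT] uT pe.
have /mapP[x /splitPr xs E] : arc_edge f \in edges_of s by rewrite (perm_mem pe) inE eqxx.
case: xs ws pe => S R ws pe; move: (ws); rewrite walk_cat /= => /and3P[wS /eqP tx wR].
case: (eq_arc_edge E) => fx; last first.
  exists (rev_walk S ++ R); rewrite -[x]arc_invK -fx.
  by apply: rt_step; apply: rev_step_inverse_first.
subst x; rewrite fa in tx; have [->|Sne] := eqVneq S [::]; first by exists R; apply: rt_refl.
have [|e he||u [[S1 [S2 [-> eu]]] [R1 [R2 [-> eu']]]]] := shared_vertex wS wR _ wT.
- by exists [::], R.
- have : e \in edges_of (S ++ f :: R) by rewrite (perm_mem pe) inE he orbT.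
  rewrite edges_of_cat !mem_cat inE => /or3P[-> //|/eqP ef|->]; last by rewrite orbT.
  by move: uT; rewrite /= -ef he.
- case: S Sne pe {ws wS tx} => // y S _ pe; apply/hasP.
  exists (arc_edge y); last by rewrite inE eqxx.
  have : arc_edge y \in edges_of (f :: T) by rewrite -(perm_mem pe) inE eqxx.
  rewrite inE => /orP[/eqP ey|//]; move: uT; rewrite -(perm_uniq pe) /= => /andP[].
  by rewrite edges_of_cat mem_cat inE /= ey eqxx orbT.
by exists (R1 ++ rev_walk S1 ++ rev_walk S2 ++ R2); apply: rev_steps_first; rewrite // eu.
Qed.

Theorem kotzig a b s T : walk a b s -> walk a b T -> uniq (edges_of T) ->
  perm_eq (edges_of s) (edges_of T) -> rev_steps a s T.
Proof.
elim: T a s => [|f T IH] a s ws wT uT pe.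
  by move/perm_nilP: pe; case: s {ws} => // _; apply: rt_refl.
have [s' st] := kotzig_first ws wT uT pe; apply: (rt_trans _ _ _ _ _ st); apply: rev_steps_cons.
have /andP[_ ws'] := rev_steps_walk st ws; have /andP[_ wT'] := wT; have /andP[_ uT'] := uT.
apply: IH ws' wT' uT' _; have : perm_eq (edges_of (f :: s')) (edges_of (f :: T)).
  by apply: perm_trans pe; rewrite perm_sym (rev_steps_edges st).
by rewrite /= perm_cons.
Qed.

End Walks.

Section WalkLabels.
Local Open Scope group_scope.
Variables (Gamma : groupType) (G : graph) (gamma : arc_of G -> Gamma).
Hypothesis gammaV : group_labeling gamma.
Implicit Types (a b : vertex G) (s P Q R : seq (arc_of G)).

Local Notation label := (trail_label gamma).

Lemma label_cat s1 s2 : label (s1 ++ s2) = label s1 * label s2.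
Proof. exact: big_cat. Qed.

Lemma label_rev_walk s : label (rev_walk s) = (label s)^-1.
Proof.
elim: s => [|x s IH]; first by rewrite /trail_label !big_nil invg1.
by rewrite rev_walk_cons -cats1 label_cat IH /trail_label big_seq1 big_cons invgM gammaV.
Qed.

Definition visit_at a s (t : nat) : vertex G := end_vertex a (take t s).

Definition prefix_label s (t : nat) : Gamma := label (take t s).

Lemma take_rev_step P Q R t : take t (P ++ rev_walk Q ++ R) =
  if (t < size P)%N then take t (P ++ Q ++ R)
  else if (t <= size P + size Q)%N then P ++ rev_walk (drop (size P + size Q - t) Q)
  else P ++ rev_walk Q ++ take (t - (size P + size Q)) R.
Proof.
have [tP|Pt] := ltnP t (size P); first by rewrite !take_cat tP.
rewrite take_cat ltnNge Pt /= take_cat size_rev_walk.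
have [tQ|tQ] := leqP t (size P + size Q).
  have [tq|tq] := ltnP (t - size P) (size Q).
    by rewrite /rev_walk take_rev size_map -map_drop; congr (_ ++ rev (map _ (drop _ _))); lia.
  have -> : (t - size P - size Q = 0)%N by lia.
  have -> : (size P + size Q - t = 0)%N by lia.
  by rewrite take0 cats0 drop0.
by rewrite ifN ?subnDA // -leqNgt; lia.
Qed.

Lemma chord_label_segment P Q R :
  chord_label (prefix_label (P ++ Q ++ R)) (size P) (size P + size Q) =
  label P * label Q * (label P)^-1.
Proof.
rewrite /chord_label /prefix_label takeD take_size_cat // drop_size_cat // take_size_cat //.
by rewrite label_cat.
Qed.

Lemma chord_segment a P Q R : end_vertex a P = end_vertex a (P ++ Q) ->
  chord (size (P ++ Q ++ R)) (visit_at a (P ++ Q ++ R)) (end_vertex a P)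
    (size P) (size P + size Q).
Proof.
move=> E; have tP : take (size P) (P ++ Q ++ R) = P by rewrite take_size_cat.
have tPQ : take (size P + size Q) (P ++ Q ++ R) = P ++ Q by rewrite catA -size_cat take_size_cat.
by rewrite /chord /visit /visit_at tP tPQ !size_cat; split; split=> //; lia.
Qed.

Lemma chord_segmentP a s r q : (r <= q)%N ->
  chord (size s) (visit_at a s) (visit_at a s r) r q ->
  exists P Q R, [/\ s = P ++ Q ++ R, size P = r, (size P + size Q = q)%N &
                   end_vertex a P = end_vertex a (P ++ Q)].
Proof.
move=> rq [_ [qn vrq]]; exists (take r s), (take (q - r) (drop r s)), (drop (q - r) (drop r s)).
have rn : (r <= size s)%N by lia.
by rewrite !cat_take_drop !size_takel ?size_drop ?leq_sub2r // -takeD !subnKC.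
Qed.

Lemma reversal_rev_step a b P Q R : walk a b (P ++ Q ++ R) ->
  end_vertex a P = end_vertex a (P ++ Q) -> selfinv (label Q) ->
  reversal (size (P ++ Q ++ R)) (size P) (size P + size Q)
    (visit_at a (P ++ Q ++ R)) (prefix_label (P ++ Q ++ R))
    (visit_at a (P ++ rev_walk Q ++ R)) (prefix_label (P ++ rev_walk Q ++ R)).
Proof.
move=> w E invQ; set s := P ++ Q ++ R.
have wQ : walk (end_vertex a P) (end_vertex a P) Q.
  by move: w; rewrite !walk_cat => /and3P[_ + _]; rewrite -end_vertex_cat -E.
have labelE := chord_label_segment P Q R; rewrite -/s in labelE.
have take_inside t : (size P <= t)%N -> (t <= size P + size Q)%N ->
    take (size P + (size P + size Q) - t) s = P ++ take (size P + size Q - t) Q.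
  move=> Pt tQ.
  have -> : (size P + (size P + size Q) - t = size P + (size P + size Q - t))%N by lia.
  by rewrite takeD take_size_cat // drop_size_cat // takel_cat //; lia.
have take_after k : (size P + size Q < k)%N -> take k s = P ++ Q ++ take (k - (size P + size Q)) R.
  move=> kPQ; rewrite -{1}(subnKC (ltnW kPQ)) takeD /s catA take_size_cat ?size_cat //.
  by rewrite drop_size_cat ?size_cat // catA.
have vE : visit_at a s (size P) = end_vertex a P by rewrite /visit_at take_size_cat.
split; rewrite ?leq_addr ?labelE ?vE ?selfinv_conj //; first exact: chord_segment.
- move=> t _; rewrite /visit_at take_rev_step /flip; case: ltnP => [|] Pt //=.
  have [tQ|tQ] := leqP t.
    rewrite take_inside //; set k := (size P + size Q - t)%N.
    rewrite -{1}(cat_take_drop k Q) walk_cat in wQ.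
    by case/andP: wQ => _ /walk_rev/walk_end; rewrite !end_vertex_cat.
  by rewrite take_after // !end_vertex_cat (walk_end (walk_rev wQ)) (walk_end wQ).
- move=> t _; rewrite /prefix_label take_rev_step /flip /twist labelE; case: ltnP => [|] Pt /=.
    by rewrite mul1g.
  have [tQ|tQ] := leqP t.
    rewrite take_inside //; set k := (size P + size Q - t)%N.
    have -> : label Q = (label (drop k Q))^-1 * (label (take k Q))^-1.
      by rewrite -{1}invQ -{1}(cat_take_drop k Q) label_cat invgM.
    by rewrite !label_cat label_rev_walk !mulgA mulgVK mulgVK.
  by rewrite take_after // mul1g !label_cat label_rev_walk invQ.
Qed.

Definition uniform_trail a b s : Prop := forall s', walk a b s' ->
  perm_eq (edges_of s) (edges_of s') -> label s' = label s.

Definition elementary_trail a s : Prop :=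
  elementary (size s) (visit_at a s) (prefix_label s).

Lemma uniform_trail_selfinv a b s P Q R : uniform_trail a b s -> walk a b (P ++ Q ++ R) ->
  perm_eq (edges_of s) (edges_of (P ++ Q ++ R)) -> end_vertex a P = end_vertex a (P ++ Q) ->
  selfinv (label Q).
Proof.
move=> uni w pe E; have st : rev_step a (P ++ Q ++ R) (P ++ rev_walk Q ++ R) by exists P, Q, R.
have := uni _ (rev_step_walk st w) (perm_trans pe (rev_step_edges st)).
by rewrite -(uni _ w pe) !label_cat label_rev_walk => /mulgI/mulIg.
Qed.

Lemma elementary_trail_selfinv a P Q R : elementary_trail a (P ++ Q ++ R) ->
  end_vertex a P = end_vertex a (P ++ Q) -> selfinv (label Q).
Proof.
move=> el /(chord_segment R)/(elementary_selfinv el); rewrite chord_label_segment.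
by rewrite selfinv_conj.
Qed.

Lemma uniform_elementary_trail a b s : walk a b s -> uniform_trail a b s ->
  elementary_trail a s.
Proof.
move=> ws uni.
pose family v p := exists s', [/\ walk a b s', perm_eq (edges_of s) (edges_of s'),
   v = visit_at a s' & p = prefix_label s'].
have segment s' u r q : walk a b s' -> perm_eq (edges_of s) (edges_of s') -> (r <= q)%N ->
    chord (size s) (visit_at a s') u r q -> exists P Q R,
    [/\ s' = P ++ Q ++ R, size P = r, (size P + size Q = q)%N,
        end_vertex a P = end_vertex a (P ++ Q) & selfinv (label Q)].
  move=> w pe rq c; have sz : size s = size s' by move/perm_size: (pe); rewrite !size_map.
  rewrite sz in c; have [_ vr] := c.1; rewrite -{}vr in c.
  have [P [Q [R [e er eq E]]]] := chord_segmentP rq c; exists P, Q, R; split=> //.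
  by rewrite e in w pe; apply: uniform_trail_selfinv uni w pe E.
apply: (@uniform_elementary _ _ _ family); last by exists s.
- move=> _ _ u r q [s' [w pe -> ->]] c rq.
  have [P [Q [R [-> <- <- _ inv]]]] := segment _ _ _ _ w pe rq c.
  by rewrite chord_label_segment selfinv_conj.
- move=> _ _ u r q [s' [w pe -> ->]] c rq.
  have [P [Q [R [e er eq E inv]]]] := segment _ _ _ _ w pe rq c.
  have st : rev_step a s' (P ++ rev_walk Q ++ R) by exists P, Q, R.
  exists (visit_at a (P ++ rev_walk Q ++ R)), (prefix_label (P ++ rev_walk Q ++ R)); split.
    exists (P ++ rev_walk Q ++ R); split=> //; first exact: rev_step_walk st w.
    exact: perm_trans pe (rev_step_edges st).
  have -> : size s = size (P ++ Q ++ R) by rewrite -e; move/perm_size: pe; rewrite !size_map.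
  by rewrite -er -eq e; rewrite e in w; apply: reversal_rev_step w E inv.
Qed.

Lemma elementary_rev_steps a b s T : rev_steps a s T -> walk a b s -> elementary_trail a s ->
  elementary_trail a T /\ label T = label s.
Proof.
elim=> {s T} [_ _ [P [Q [R [-> -> E]]]] w el|//|s1 s2 s3 st12 IH12 _ IH23 w el].
  have inv := elementary_trail_selfinv el E; rewrite !label_cat label_rev_walk inv; split=> //.
  have := elementary_reversal (reversal_rev_step w E inv) el; rewrite /elementary_trail.
  by rewrite !size_cat size_rev_walk.
have [el2 <-] := IH12 w el; exact: IH23 (rev_steps_walk st12 w) el2.
Qed.

Lemma elementary_uniform_trail a b s : walk a b s -> uniq (edges_of s) ->
  elementary_trail a s -> uniform_trail a b s.
Proof.
move=> w u el T wT pe; have uT : uniq (edges_of T) by rewrite -(perm_uniq pe).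
by case: (elementary_rev_steps (kotzig w wT uT pe) w el).
Qed.

End WalkLabels.

(** * Programs with bounded loops *)

Inductive bound := BEdges | BTimes | BArcs.

(* Register 1 holds the number [m] of edges and is never overwritten. *)
Definition bound_expr (b : bound) : expr :=
  match b with
  | BEdges => EReg 1
  | BTimes => EAdd (EReg 1) (ECst 1)
  | BArcs => EAdd (EReg 1) (EReg 1)
  end.

Definition bound_val (b : bound) (m : nat) : nat :=
  match b with BEdges => m | BTimes => m + 1 | BArcs => m + m end.

Inductive prog :=
| PSkip
| PSet of nat & expr
| PPut of nat & expr & expr
| PSeq of prog & prog
| PIf of expr & prog & prog
| PFor of nat & bound & prog
| PQuery of nat & nat & expr.

Definition query_bound : expr :=
  let triple := EAdd (EReg 1) (EAdd (EReg 1) (EReg 1)) in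
  EAdd (EAdd triple triple) (EAdd triple triple).

(* A query is guarded by a test of its length, so that its cost is at most
   [phi (12 * m)] whatever the state. *)
Fixpoint compile (p : prog) : cmd :=
  match p with
  | PSkip => CSkip
  | PSet r e => CSet r e
  | PPut t e1 e2 => CPut t e1 e2
  | PSeq p1 p2 => CSeq (compile p1) (compile p2)
  | PIf e p1 p2 => CIf e (compile p1) (compile p2)
  | PFor i b p1 =>
      CSeq (CSet i (ECst 0))
        (CWhile (ELt (EReg i) (bound_expr b))
           (CSeq (compile p1) (CSet i (EAdd (EReg i) (ECst 1)))))
  | PQuery r t e => CIf (ELt query_bound e) CSkip (CQuery r t e)
  end.

Fixpoint written_regs (p : prog) : seq nat :=
  match p with
  | PSkip | PPut _ _ _ => [::]
  | PSet r _ | PQuery r _ _ => [:: r]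
  | PSeq p1 p2 | PIf _ p1 p2 => written_regs p1 ++ written_regs p2
  | PFor i _ p1 => i :: written_regs p1
  end.

Fixpoint written_arrs (p : prog) : seq nat :=
  match p with
  | PSkip | PSet _ _ | PQuery _ _ _ => [::]
  | PPut t _ _ => [:: t]
  | PSeq p1 p2 | PIf _ p1 p2 => written_arrs p1 ++ written_arrs p2
  | PFor _ _ p1 => written_arrs p1
  end.

Fixpoint wf (p : prog) : bool :=
  match p with
  | PSkip | PPut _ _ _ => true
  | PSet r _ | PQuery r _ _ => r != 1
  | PSeq p1 p2 | PIf _ p1 p2 => wf p1 && wf p2
  | PFor i _ p1 => [&& i != 1, i \notin written_regs p1 & wf p1]
  end.

Fixpoint read_regs (e : expr) : seq nat :=
  match e with
  | ECst _ => [::]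
  | EReg r => [:: r]
  | EGet _ e1 => read_regs e1
  | EAdd e1 e2 | ESub e1 e2 | ELt e1 e2 | EEq e1 e2 => read_regs e1 ++ read_regs e2
  end.

Fixpoint read_arrs (e : expr) : seq nat :=
  match e with
  | ECst _ | EReg _ => [::]
  | EGet t e1 => t :: read_arrs e1
  | EAdd e1 e2 | ESub e1 e2 | ELt e1 e2 | EEq e1 e2 => read_arrs e1 ++ read_arrs e2
  end.

Definition avoids (p : prog) (rs ts : seq nat) : bool :=
  all (fun r => r \notin written_regs p) rs && all (fun t => t \notin written_arrs p) ts.

Definition frame (p : prog) (s s' : state) : Prop :=
  (forall r, r \notin written_regs p -> reg s' r = reg s r) /\
  (forall t, t \notin written_arrs p -> arr s' t =1 arr s t).

Definition depends_on (rs ts : seq nat) (Q : state -> Prop) : Prop :=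
  forall s s', {in rs, reg s' =1 reg s} -> (forall t, t \in ts -> arr s' t =1 arr s t) ->
    Q s -> Q s'.

Definition ignores (r : nat) (Q : state -> Prop) : Prop :=
  forall s v, Q s -> Q (set_reg s r v).

(* [reg (set_reg s r v) r'] reduces to [reg s r'] for numerals [r] and [r']: the two instances of
   a predicate that does not read [r] are convertible. *)
#[global] Hint Extern 0 (ignores _ _) => (do 3 intro; assumption) : core.

Definition for_range (i : nat) (b : bound) (lo hi : expr) (p : prog) : prog :=
  PFor i b (PIf (ELt (EReg i) lo) PSkip (PIf (ELt (EReg i) hi) p PSkip)).

Definition for_pairs (i j : nat) (b : bound) (lo hi : expr) (p : prog) : prog :=
  for_range i b lo hi (for_range j b lo hi p).

Lemma depends_on_sub rs ts rs' ts' (Q : state -> Prop) :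
  all (mem rs') rs -> all (mem ts') ts -> depends_on rs ts Q -> depends_on rs' ts' Q.
Proof.
by move=> /allP sr /allP st dep s s' er ea; apply: dep => [r /sr|t /st]; [apply: er | apply: ea].
Qed.

Lemma depends_on_ignores rs ts (Q : state -> Prop) r :
  depends_on rs ts Q -> r \notin rs -> ignores r Q.
Proof.
move=> dep rrs s v; apply: dep => // r' r'rs /=.
by case: eqP r'rs rrs => // -> ->.
Qed.

Lemma depends_on_set_arr rs ts (Q : state -> Prop) s t i v :
  depends_on rs ts Q -> t \notin ts -> Q s -> Q (set_arr s t i v).
Proof.
move=> dep tts; apply: dep => // t' t'ts j /=.
by case: eqP t'ts tts => // -> ->.
Qed.

Lemma frame_depends_on rs ts (Q : state -> Prop) p s s' :
  depends_on rs ts Q -> frame p s s' -> avoids p rs ts -> Q s -> Q s'.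
Proof.
move=> dep [fr fa] /andP[/allP av_r /allP av_t]; apply: dep => [r /av_r/fr //|t /av_t].
exact: fa.
Qed.

Lemma eval_depends_on e v : depends_on (read_regs e) (read_arrs e) (fun s => eval_expr s e = v).
Proof.
move=> s s' er ea <-; elim: e er ea => //=.
- by move=> r er _; apply: er; rewrite inE.
- move=> t e IH er ea; rewrite ea ?inE ?eqxx // IH // => t' t'e; apply: ea.
  by rewrite inE t'e orbT.
all: move=> e1 IH1 e2 IH2 er ea.
all: by rewrite IH1 ?IH2 // => x xe; do [apply: er | apply: ea]; rewrite mem_cat xe ?orbT.
Qed.

Lemma frame_trans p s1 s2 s3 : frame p s1 s2 -> frame p s2 s3 -> frame p s1 s3.
Proof.
move=> [r12 a12] [r23 a23]; split=> [r ?|t ? i]; first by rewrite r23 // r12.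
by rewrite a23 // a12.
Qed.

Lemma avoids_cat p rs1 rs2 ts1 ts2 :
  avoids p (rs1 ++ rs2) (ts1 ++ ts2) = avoids p rs1 ts1 && avoids p rs2 ts2.
Proof. by rewrite /avoids !all_cat; do 4!case: (all _ _). Qed.

Lemma avoids_sub p p' rs ts : {subset written_regs p <= written_regs p'} ->
  {subset written_arrs p <= written_arrs p'} -> avoids p' rs ts -> avoids p rs ts.
Proof.
move=> sr sa /andP[/allP av_r /allP av_t]; apply/andP; split; apply/allP => x.
  by move/av_r; apply/contra/sr.
by move/av_t; apply/contra/sa.
Qed.

Lemma frame_sub p p' s s' : {subset written_regs p <= written_regs p'} ->
  {subset written_arrs p <= written_arrs p'} -> frame p s s' -> frame p' s s'.
Proof.
move=> sr sa [fr fa]; split=> [r|t] nwr.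
  by apply: fr; apply: contra nwr; apply: sr.
by apply: fa; apply: contra nwr; apply: sa.
Qed.

Section Denotation.
Variable oracle : seq nat -> bool.

Fixpoint den (p : prog) (s : state) : state :=
  match p with
  | PSkip => s
  | PSet r e => set_reg s r (eval_expr s e)
  | PPut t e1 e2 => set_arr s t (eval_expr s e1) (eval_expr s e2)
  | PSeq p1 p2 => den p2 (den p1 s)
  | PIf e p1 p2 => if eval_expr s e != 0 then den p1 s else den p2 s
  | PFor i b p1 =>
      iter (bound_val b (reg s 1))
        (fun s1 => let s2 := den p1 s1 in set_reg s2 i (reg s2 i + 1)) (set_reg s i 0)
  | PQuery r t e =>
      if eval_expr s query_bound < eval_expr s e then s
      else set_reg s r (oracle (mkseq (arr s t) (eval_expr s e)))
  end.

Lemma den_frame p s : frame p s (den p s).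
Proof.
elim: p s => [|r e|t e1 e2|p1 IH1 p2 IH2|e p1 IH1 p2 IH2|i b p IH|r t e] s.
- by [].
- by split=> //= r'; rewrite inE => /negbTE ->.
- by split=> //= t' + i; rewrite inE => /negbTE ->.
- apply: frame_trans; [apply: frame_sub (IH1 s) | apply: frame_sub (IH2 _)];
  by move=> x xp; rewrite mem_cat xp ?orbT.
- rewrite /=; case: ifP => _; [apply: frame_sub (IH1 s) | apply: frame_sub (IH2 s)];
  by move=> x xp; rewrite mem_cat xp ?orbT.
- rewrite /=; elim: (bound_val _ _) => [|n IHn].
    by split=> //= r; rewrite inE negb_or => /andP[/negbTE ->].
  apply: frame_trans IHn _; split=> [r|t h j] /=; last by rewrite (IH _).2.
  by rewrite inE negb_or => /andP[/negbTE -> h]; rewrite (IH _).1.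
- by rewrite /=; case: ifP => _; split=> //= r'; rewrite inE => /negbTE ->.
Qed.

Lemma wf_reg1 p : wf p -> 1 \notin written_regs p.
Proof.
elim: p => //= [r e|p1 IH1 p2 IH2|e p1 IH1 p2 IH2|i b p IH|r t e].
- by rewrite inE eq_sym.
- by case/andP=> /IH1 n1 /IH2 n2; rewrite mem_cat negb_or n1.
- by case/andP=> /IH1 n1 /IH2 n2; rewrite mem_cat negb_or n1.
- by case/and3P=> i1 _ /IH; rewrite inE negb_or eq_sym i1.
- by rewrite inE eq_sym.
Qed.

Lemma den_reg1 p s : wf p -> reg (den p s) 1 = reg s 1.
Proof. by move/wf_reg1; apply: (den_frame p s).1. Qed.

Lemma reg_den p s r : r \notin written_regs p -> reg (den p s) r = reg s r.
Proof. exact: (den_frame p s).1. Qed.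

Lemma arr_den p s t : t \notin written_arrs p -> arr (den p s) t =1 arr s t.
Proof. exact: (den_frame p s).2. Qed.

Lemma den_seq p1 p2 s : den (PSeq p1 p2) s = den p2 (den p1 s).
Proof. by []. Qed.

Lemma den_set r e s : den (PSet r e) s = set_reg s r (eval_expr s e).
Proof. by []. Qed.

Lemma den_put t e1 e2 s :
  den (PPut t e1 e2) s = set_arr s t (eval_expr s e1) (eval_expr s e2).
Proof. by []. Qed.

Lemma den_if e p1 p2 s :
  den (PIf e p1 p2) s = if eval_expr s e != 0 then den p1 s else den p2 s.
Proof. by []. Qed.

Lemma den_if_eq e1 e2 p1 p2 s : den (PIf (EEq e1 e2) p1 p2) s =
  if eval_expr s e1 == eval_expr s e2 then den p1 s else den p2 s.
Proof. by rewrite den_if /=; case: (eval_expr s e1 == _). Qed.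

Lemma den_if_lt e1 e2 p1 p2 s : den (PIf (ELt e1 e2) p1 p2) s =
  if eval_expr s e1 < eval_expr s e2 then den p1 s else den p2 s.
Proof. by rewrite den_if /=; case: (_ < _). Qed.

Lemma den_skip s : den PSkip s = s.
Proof. by []. Qed.

Lemma den_query r t e s m : reg s 1 = m -> eval_expr s e <= 12 * m ->
  den (PQuery r t e) s = set_reg s r (oracle (mkseq (arr s t) (eval_expr s e))).
Proof.
move=> sm le; have E : eval_expr s query_bound = 12 * m by rewrite /= sm; lia.
by rewrite /den -/den E ltnNge le.
Qed.

Lemma seq_rule (Q R : state -> Prop) p1 p2 s : R (den p1 s) ->
  (forall s1, frame p1 s s1 -> R s1 -> Q (den p2 s1)) -> Q (den (PSeq p1 p2) s).
Proof. by move=> Rs; apply; last exact: Rs; apply: den_frame. Qed.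

Lemma for_rule (I : nat -> state -> Prop) i b p s n :
  wf (PFor i b p) -> bound_val b (reg s 1) = n -> (forall j, ignores i (I j)) -> I 0 s ->
  (forall j s', j < n -> reg s' i = j -> frame (PFor i b p) s s' -> I j s' ->
     I j.+1 (den p s')) ->
  I n (den (PFor i b p) s).
Proof.
move=> /= /and3P[_ ip _] -> ign I0 step; set body := fun s1 => _.
suff : forall j, j <= n -> let s' := iter j body (set_reg s i 0) in
    [/\ reg s' i = j, frame (PFor i b p) s s' & I j s'].
  by move=> /(_ n (leqnn _)) [].
elim=> [_|j IH jn] /=.
  split; [by rewrite eqxx | | exact: ign].
  by split=> //= r; rewrite inE negb_or => /andP[/negbTE ->].
have [ri fr Ij] := IH (ltnW jn); set s1 := iter j body _ in ri fr Ij *.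
have E : reg (den p s1) i = j by rewrite reg_den.
rewrite /body /= E addn1; split; first by rewrite eqxx.
- apply: frame_trans fr _; split=> /= [r|t h l]; last by rewrite arr_den.
  by rewrite inE negb_or => /andP[/negbTE -> h]; rewrite reg_den.
- by apply: ign; apply: step.
Qed.

#[local] Arguments den : simpl never.

Lemma for_range_rule (I : nat -> state -> Prop) i b lo hi p s l n :
  wf (for_range i b lo hi p) ->
  avoids (for_range i b lo hi p) (read_regs lo ++ read_regs hi) (read_arrs lo ++ read_arrs hi) ->
  eval_expr s lo = l -> eval_expr s hi = l + n -> l + n <= bound_val b (reg s 1) ->
  (forall j, ignores i (I j)) -> I 0 s ->
  (forall j s', j < n -> reg s' i = l + j -> frame (for_range i b lo hi p) s s' -> I j s' ->
     I j.+1 (den p s')) ->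
  I n (den (for_range i b lo hi p) s).
Proof.
move=> w; rewrite avoids_cat => /andP[av_lo av_hi] lE hE le ign I0 step.
suff : I (minn (bound_val b (reg s 1) - l) n) (den (for_range i b lo hi p) s).
  by rewrite (_ : minn _ _ = n) //; lia.
apply: (for_rule (I := fun j => I (minn (j - l) n))) w erefl _ _ _ => //; first by rewrite min0n.
move=> j s' _ ij fr Ij; have lE' : eval_expr s' lo = l.
  by apply: frame_depends_on (@eval_depends_on lo l) fr av_lo lE.
have hE' : eval_expr s' hi = l + n.
  by apply: frame_depends_on (@eval_depends_on hi (l + n)) fr av_hi hE.
rewrite den_if_lt /= ij lE'; case: ltnP => [lt|ge].
  by rewrite den_skip (_ : j.+1 - l = j - l) //; lia.
rewrite den_if_lt /= ij hE'; case: ltnP => [lt|ge']; last first.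
  by rewrite den_skip (_ : minn (j.+1 - l) n = minn (j - l) n) //; lia.
rewrite (_ : minn (j.+1 - l) n = (j - l).+1); last by lia.
by apply: step fr _; [lia | lia | rewrite (_ : j - l = minn (j - l) n) //; lia].
Qed.

Lemma for_pairs_rule (I : (nat -> nat -> Prop) -> state -> Prop) i j b lo hi p s l n :
  wf (for_pairs i j b lo hi p) ->
  avoids (for_pairs i j b lo hi p) (read_regs lo ++ read_regs hi) (read_arrs lo ++ read_arrs hi) ->
  eval_expr s lo = l -> eval_expr s hi = l + n -> l + n <= bound_val b (reg s 1) ->
  (forall D, ignores i (I D)) -> (forall D, ignores j (I D)) ->
  (forall (D D' : nat -> nat -> Prop) s', (forall x y, x < n -> y < n -> D' x y -> D x y) ->
     I D s' -> I D' s') ->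
  I (fun _ _ => False) s ->
  (forall D x y s', x < n -> y < n -> reg s' i = l + x -> reg s' j = l + y ->
     frame (for_pairs i j b lo hi p) s s' -> I D s' ->
     I (fun x' y' => D x' y' \/ x' = x /\ y' = y) (den p s')) ->
  I (fun _ _ => True) (den (for_pairs i j b lo hi p) s).
Proof.
move=> w av lE hE le ign_i ign_j weaken I0 step; set inner := for_range j b lo hi p.
have sub_regs : {subset written_regs inner <= written_regs (for_range i b lo hi inner)}.
  by move=> r h; apply/orP; right; rewrite /= cats0.
have sub_arrs : {subset written_arrs inner <= written_arrs (for_range i b lo hi inner)}.
  by move=> t h; rewrite /= cats0.
have w_in : wf inner by case/and3P: w => _ _ /=; rewrite andbT.
have ij : i \notin written_regs inner by case/and3P: w => _; rewrite /= cats0.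
have := av; rewrite avoids_cat => /andP[av_lo av_hi].
suff : I (fun x' _ => x' < n) (den (for_range i b lo hi inner) s) by apply: weaken.
apply: (for_range_rule (I := fun x => I (fun x' _ => x' < x)) w _ lE hE le) => //.
  by apply: weaken I0.
move=> x s1 xn s1i fr1 I1; pose done y x' y' := x' < x \/ x' = x /\ y' < y.
suff : I (done n) (den inner s1) by apply: weaken => x' y' _ yn; rewrite /done; lia.
apply: (for_range_rule (I := fun y => I (done y)) (l := l)) => //.
- exact: avoids_sub sub_regs sub_arrs av.
- exact: frame_depends_on (@eval_depends_on lo l) fr1 av_lo lE.
- exact: frame_depends_on (@eval_depends_on hi (l + n)) fr1 av_hi hE.
- by rewrite fr1.1 // (wf_reg1 w).
- by apply: weaken I1 => x' y' _ _; rewrite /done; lia.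
move=> y s2 yn s2j fr2 I2.
suff : I (fun x' y' => done y x' y' \/ x' = x /\ y' = y) (den p s2).
  by apply: weaken => x' y' _ _; rewrite /done; lia.
apply: step => //; first by rewrite fr2.1.
exact: frame_trans fr1 (frame_sub sub_regs sub_arrs fr2).
Qed.

End Denotation.

Arguments den : simpl never.

Definition denE := (den_seq, den_set, den_put, den_if_eq, den_if_lt, den_if, den_skip).

Section Cost.
Variables (oracle : seq nat -> bool) (phi : nat -> nat).
Hypothesis phi_mono : forall i j, i <= j -> phi i <= phi j.

Fixpoint cost (m F : nat) (p : prog) : nat :=
  match p with
  | PSkip => 1
  | PSet r e => (expr_cost e).+1
  | PPut t e1 e2 => (expr_cost e1 + expr_cost e2).+1
  | PSeq p1 p2 => cost m F p1 + cost m F p2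
  | PIf e p1 p2 => (expr_cost e + (cost m F p1 + cost m F p2)).+1
  | PFor i b p1 => 8 + bound_val b m * (cost m F p1 + 10)
  | PQuery r t e => expr_cost (ELt query_bound e) + expr_cost e + F + 2
  end.

(* The cost is at most [cost_coef p] times the product of a factor [m.+1] for each level of
   loops but the innermost, and of a factor [F.+1] for the innermost loop or a query. *)
Fixpoint cost_deg (p : prog) : nat :=
  match p with
  | PSkip | PSet _ _ | PPut _ _ _ => 0
  | PSeq p1 p2 | PIf _ p1 p2 => maxn (cost_deg p1) (cost_deg p2)
  | PFor _ _ p1 => (cost_deg p1).+1
  | PQuery _ _ _ => 1
  end.

Fixpoint cost_coef (p : prog) : nat :=
  match p with
  | PSkip => 1
  | PSet r e => (expr_cost e).+1
  | PPut t e1 e2 => (expr_cost e1 + expr_cost e2).+1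
  | PSeq p1 p2 => cost_coef p1 + cost_coef p2
  | PIf e p1 p2 => (expr_cost e + (cost_coef p1 + cost_coef p2)).+1
  | PFor i b p1 => 8 + 2 * (cost_coef p1 + 10)
  | PQuery r t e => expr_cost (ELt query_bound e) + expr_cost e + 2
  end.

Definition cost_power (N M d : nat) : nat := if d is d'.+1 then N ^ d' * M else 1.

Lemma eval_bound s b : eval_expr s (bound_expr b) = bound_val b (reg s 1).
Proof. by case: b. Qed.

Lemma exec_for i b p s m c : wf (PFor i b p) -> reg s 1 = m ->
  (forall s1, reg s1 1 = m ->
     exists2 t, exec oracle phi (compile p) s1 t (den oracle p s1) & t <= c) ->
  exists2 t, exec oracle phi (compile (PFor i b p)) s t (den oracle (PFor i b p) s) &
    t <= 8 + bound_val b m * (c + 10).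
Proof.
move=> /and3P[i1 ip wp] sm exec_body; set test := ELt (EReg i) (bound_expr b).
pose body s1 := let s2 := den oracle p s1 in set_reg s2 i (reg s2 i + 1).
pose loop := CWhile test (CSeq (compile p) (CSet i (EAdd (EReg i) (ECst 1)))).
have test_cost : expr_cost test <= 5 by rewrite /test; case: (b).
have exec_loop k s1 : reg s1 1 = m -> reg s1 i + k = bound_val b m ->
    exists2 t, exec oracle phi loop s1 t (iter k body s1) & t <= 6 + k * (c + 10).
  elim: k s1 => [|k IHk] s1 s1m s1i.
    exists (expr_cost test).+1; last by lia.
    by apply: ExecWhileFalse; rewrite /= eval_bound s1m -s1i addn0 ltnn.
  have [t1 e1 le1] := exec_body s1 s1m.
  have [||t2 e2 le2] := IHk (body s1).
  - by rewrite /= eq_sym (negbTE i1) den_reg1.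
  - by rewrite /= eqxx reg_den //; lia.
  exists (expr_cost test + (t1 + 4) + t2).+1; last by rewrite mulSn; lia.
  rewrite iterSr; apply: ExecWhileTrue e2; first by rewrite /= eval_bound s1m -s1i; lia.
  by apply: ExecSeq e1 _; apply: ExecSet.
have [||t e le] := exec_loop (bound_val b m) (set_reg s i 0).
- by rewrite /= eq_sym (negbTE i1).
- by rewrite /= eqxx.
exists (2 + t); last by lia.
by rewrite /den -/den sm; apply: ExecSeq e; apply: ExecSet.
Qed.

Lemma exec_query r t e s m : reg s 1 = m ->
  exists2 n, exec oracle phi (compile (PQuery r t e)) s n (den oracle (PQuery r t e) s) &
    n <= cost m (phi (12 * m)) (PQuery r t e).
Proof.
move=> sm; have boundE : eval_expr s query_bound = 12 * m by rewrite /= sm; lia.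
have testE : eval_expr s (ELt query_bound e) = (12 * m < eval_expr s e) by rewrite -boundE.
rewrite /den -/den boundE; case: ltnP testE => le testE.
  exists (expr_cost (ELt query_bound e) + 1).+1; last by rewrite /=; lia.
  by apply: ExecIfTrue; [rewrite testE | apply: ExecSkip].
exists (expr_cost (ELt query_bound e) + (expr_cost e + phi (eval_expr s e)).+1).+1; last first.
  by have := phi_mono le; rewrite /=; lia.
by apply: ExecIfFalse; last exact: ExecQuery.
Qed.

Lemma exec_compile p s m : wf p -> reg s 1 = m ->
  exists2 t, exec oracle phi (compile p) s t (den oracle p s) & t <= cost m (phi (12 * m)) p.
Proof.
elim: p s => [|r e|t e1 e2|p1 IH1 p2 IH2|e p1 IH1 p2 IH2|i b p IH|r t e] s.
- by exists 1 => //; apply: ExecSkip.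
- by exists (expr_cost e).+1 => //; apply: ExecSet.
- by exists (expr_cost e1 + expr_cost e2).+1 => //; apply: ExecPut.
- move=> /= /andP[w1 w2] sm; have [t1 e1 le1] := IH1 s w1 sm.
  have [t2 e2 le2] := IH2 (den oracle p1 s) w2 (etrans (den_reg1 oracle s w1) sm).
  by exists (t1 + t2); [apply: ExecSeq e1 e2 | lia].
- move=> /= /andP[w1 w2] sm; rewrite den_if; case: ifP => test.
    have [t1 e1 le1] := IH1 s w1 sm.
    by exists (expr_cost e + t1).+1; [apply: ExecIfTrue | lia].
  have [t2 e2 le2] := IH2 s w2 sm.
  by exists (expr_cost e + t2).+1; [apply: ExecIfFalse => //; apply/eqP/negbFE | lia].
- move=> w sm; have /and3P[_ _ wp] := w.
  by apply: exec_for w sm _ => s1; apply: IH.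
- by move=> _; apply: exec_query.
Qed.

Lemma leq_cost_power N M d : 0 < N -> N <= M -> N * cost_power N M d <= cost_power N M d.+1.
Proof. by case: d => [|d] *; rewrite /= ?expn0 ?mul1n ?muln1 // expnS mulnA. Qed.

Lemma cost_power_mono N M d1 d2 : 0 < N -> N <= M -> d1 <= d2 ->
  cost_power N M d1 <= cost_power N M d2.
Proof.
move=> N0 NM /subnKC <-; elim: (d2 - d1) => [|k IH]; rewrite ?addn0 // addnS.
by apply: leq_trans IH _; apply: leq_trans (leq_cost_power _ N0 NM); rewrite leq_pmull.
Qed.

Lemma cost_le m F p : m <= F -> cost m F p <= cost_coef p * cost_power m.+1 F.+1 (cost_deg p).
Proof.
move=> mF; set power := cost_power m.+1 F.+1.
have stepP d : m.+1 * power d <= power d.+1 by apply: leq_cost_power.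
have mono d1 d2 : d1 <= d2 -> power d1 <= power d2 by apply: cost_power_mono.
have pos d : 0 < power d by apply: leq_trans (mono 0 d _).
have maxP d1 d2 : power d1 <= power (maxn d1 d2) /\ power d2 <= power (maxn d1 d2).
  by split; apply: mono; rewrite ?leq_maxl ?leq_maxr.
elim: p => [|r e|t e1 e2|p1 IH1 p2 IH2|e p1 IH1 p2 IH2|i b p IH|r t e]; rewrite /= ?muln1 //.
- have [max1 max2] := maxP (cost_deg p1) (cost_deg p2).
  by rewrite mulnDl leq_add //; [apply: leq_trans IH1 _|apply: leq_trans IH2 _];
    rewrite leq_mul2l ?max1 ?max2 orbT.
- have [max1 max2] := maxP (cost_deg p1) (cost_deg p2).
  have := pos (maxn (cost_deg p1) (cost_deg p2)).
  move: (power (maxn _ _)) max1 max2 => x max1 max2 x0.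
  have {}IH1 := leq_trans IH1 (leq_mul (leqnn _) max1).
  have {}IH2 := leq_trans IH2 (leq_mul (leqnn _) max2).
  by nia.
- have bm : bound_val b m <= 2 * m.+1 by case: b; rewrite /=; lia.
  have := stepP (cost_deg p); have := pos (cost_deg p).
  rewrite -[_ ^ _ * _]/(power (cost_deg p).+1).
  move: (power _) (power _.+1) IH => x z IH x0 xz.
  have : bound_val b m * (cost m F p + 10) <= 2 * m.+1 * ((cost_coef p + 10) * x).
    by apply: leq_mul => //; nia.
  by nia.
- by rewrite expn0 mul1n; nia.
Qed.

Lemma cost_power_le m F d : 0 < m -> m <= F ->
  cost_power m.+1 F.+1 d.+1 <= (2 ^ d).*2 * m ^ d * F.
Proof.
move=> m0 mF; have powS : m.+1 ^ d <= 2 ^ d * m ^ d.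
  by case: d => // d; rewrite -expnMn leq_exp2r //; lia.
have FS : F.+1 <= 2 * F by lia.
by have := leq_mul powS FS; rewrite /= -muln2; nia.
Qed.

Lemma exec_within p s m d C : wf p -> reg s 1 = m -> m <= phi (12 * m) ->
  cost_deg p = d.+1 -> (2 ^ d).*2 * cost_coef p <= C ->
  exists2 t, exec oracle phi (compile p) s t (den oracle p s) &
    0 < m -> t <= C * m ^ d * phi (12 * m).
Proof.
move=> w sm mF dp coefC; have [t ex le] := exec_compile w sm; exists t => // m0.
apply: leq_trans le _; apply: leq_trans (cost_le p mF) _; rewrite dp.
apply: (@leq_trans ((2 ^ d).*2 * cost_coef p * m ^ d * phi (12 * m))).
  by rewrite -!mulnA mulnCA leq_mul2l !mulnA cost_power_le ?orbT.
by rewrite !leq_mul2r coefC !orbT.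
Qed.

End Cost.

(** * Completing a trail *)

Section Completions.
Variable G : graph.
Local Notation m := (nedges G).
Implicit Types (a b c p v x : vertex G) (z y f : arc_of G) (s S T P O : seq (arc_of G)).

Lemma arc_code_lt z : arc_code z < m + m.
Proof. by case: z => e []; rewrite /arc_code /=; have := ltn_ord e; lia. Qed.

Lemma arc_code_inj : injective (@arc_code G).
Proof.
move=> [e o] [e' o']; rewrite /arc_code /=; have := ltn_ord e; have := ltn_ord e'.
by case: o; case: o' => ? ? ?; first [congr (_, _); apply: val_inj => /=; lia | lia].
Qed.

Lemma arc_code_surj (i : nat) : i < m + m -> exists z, arc_code z = i.
Proof.
move=> ilt; have [lt|ge] := ltnP i m; first by exists (Ordinal lt, false).
have lt : i - m < m by lia.
by exists (Ordinal lt, true); rewrite /arc_code /=; lia.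
Qed.

Lemma arc_code_inv z :
  arc_code (arc_inv z) = if arc_code z < m then arc_code z + m else arc_code z - m.
Proof.
case: z => e []; rewrite /arc_code /arc_inv /= -?(addnC e) ?ltn_ord //.
by rewrite ltnNge leq_addl addnK.
Qed.

Lemma arc_code_edge z :
  arc_edge z = (if arc_code z < m then arc_code z else arc_code z - m) :> nat.
Proof.
case: z => e []; rewrite /arc_code /= ?ltn_ord //.
by rewrite ltnNge leq_addr addKn.
Qed.

Lemma size_edges_of s : size (edges_of s) = size s.
Proof. exact: size_map. Qed.

Lemma size_uniq_edges s : uniq (edges_of s) -> size s <= m.
Proof.
by move/card_uniqP; rewrite size_edges_of => <-; rewrite -[X in _ <= X]card_ord max_card.
Qed.

Lemma all_edges s e : uniq (edges_of s) -> size s = m -> e \in edges_of s.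
Proof.
move=> u sz; have /card_uniqP E := u.
have /subset_cardP full : #|edges_of s| = #|'I_m| by rewrite card_ord E size_edges_of.
by have /full -> : edges_of s \subset 'I_m by apply/subsetP.
Qed.

Lemma size_all_edges s : uniq (edges_of s) -> (forall e, e \in edges_of s) -> size s = m.
Proof.
move=> u all; rewrite -size_edges_of -[RHS]card_ord -(card_uniqP u).
by apply: eq_card => e; rewrite all.
Qed.

Definition completes P x b T : Prop :=
  [/\ walk x b T, uniq (edges_of (P ++ T)) & size P + size T = m].

Lemma completes_nilP a b T : completes [::] a b T <-> eulerian_trail a b T.
Proof.
split=> [[w u sz]|[/andP[w u] all]]; last by split=> //; apply: size_all_edges.
by split; [rewrite /trail w | move=> e; apply: all_edges].
Qed.

Lemma completes_nil_size a b T : completes [::] a b T -> size T = m.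
Proof. by case. Qed.

Lemma completes_perm P x b T T' : completes P x b T -> completes P x b T' ->
  perm_eq (edges_of T) (edges_of T').
Proof.
move=> [_ u sz] [_ u' sz']; rewrite -(perm_cat2l (edges_of P)) -!edges_of_cat.
by apply: uniq_perm => // e; rewrite !all_edges ?size_cat.
Qed.

Lemma perm_completes P x b T T' : completes P x b T -> walk x b T' ->
  perm_eq (edges_of T) (edges_of T') -> completes P x b T'.
Proof.
move=> [_ u sz] w pe; split=> //; last first.
  by rewrite -(size_edges_of T') -(perm_size pe) size_edges_of.
have /perm_uniq <- // : perm_eq (edges_of (P ++ T)) (edges_of (P ++ T')).
by rewrite !edges_of_cat perm_cat2l.
Qed.

Lemma completes_cons P x b f T : completes P x b (f :: T) <->
  arc_tail f = x /\ completes (rcons P f) (arc_head f) b T.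
Proof.
rewrite /completes cat_rcons size_rcons /= addnS addSn.
by split=> [[/andP[/eqP ? ?] ? ?]|[-> [? ? ?]]]; rewrite ?eqxx.
Qed.

Lemma completes_cat a b P x T : walk a x P -> completes P x b T -> completes [::] a b (P ++ T).
Proof.
by move=> wP [wT u sz]; split; rewrite ?size_cat // walk_cat (walk_end wP) wP.
Qed.

Definition incidence v (es : seq (edge G)) : nat :=
  \sum_(e <- es) ((src e == v) + (tgt e == v)).

Lemma walk_incidence a b v s : walk a b s ->
  odd (incidence v (edges_of s)) = (a == v) (+) (b == v).
Proof.
elim: s a => [|[e o] s IH] a /=.
  by move=> /eqP ->; rewrite /incidence big_nil addbb.
case/andP=> /eqP <- /IH E; rewrite /incidence big_cons oddD -/(incidence v _) E.
by case: o E => E; rewrite /arc_tail /arc_head /= oddD !oddb;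
  case: (src e == v); case: (tgt e == v); case: (b == v).
Qed.

Definition saturated (es : seq (edge G)) v : Prop :=
  forall z, arc_tail z = v -> arc_edge z \in es.

Lemma saturated_incidence v es fs : uniq es -> uniq fs -> (forall e, e \in fs) ->
  saturated es v -> incidence v es = incidence v fs.
Proof.
move=> ue uf all sat; rewrite /incidence !big_uniq //=.
rewrite [RHS](eq_bigl predT) => [|e]; last by rewrite all.
rewrite [RHS](bigID (mem es)) /= [X in _ + X]big1 ?addn0 // => e ne.
case: eqP => [E|_]; first by have := sat (e, false) E; rewrite /arc_edge /= (negbTE ne).
by case: eqP => [E|//]; have := sat (e, true) E; rewrite /arc_edge /= (negbTE ne).
Qed.

Lemma stuck_vertex P S O T x c p b : uniq (edges_of (P ++ S ++ O)) -> completes P x b T ->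
  walk x c S -> walk p b O -> saturated (edges_of (P ++ S ++ O)) c -> c = p.
Proof.
move=> u [wT uT sT] wS wO sat.
have all e : e \in edges_of (P ++ T) by apply: all_edges; rewrite ?size_cat.
have := saturated_incidence u uT all sat.
rewrite !edges_of_cat /incidence !big_cat /= => /addnI /(congr1 odd).
rewrite oddD -!/(incidence _ _) (walk_incidence _ wS) (walk_incidence _ wO) (walk_incidence _ wT).
by rewrite eqxx; case: (x == c); case: (b == c); case: eqP => // ->.
Qed.

Lemma walk_arc_tail x b O y : walk x b O -> y \in O ->
  arc_tail y = x \/ exists2 y', y' \in O & arc_tail y = arc_head y'.
Proof.
move=> w /splitPr yO; case: yO w => s1 s2; rewrite walk_cat /= => /and3P[_ /eqP -> _].
case: (lastP s1) => [|s y']; [by left | right; exists y'; last by rewrite end_vertex_rcons].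
by rewrite mem_cat mem_rcons inE eqxx.
Qed.

Lemma saturated_walk_sub P O x b c T : walk x b O -> saturated (edges_of (P ++ O)) x ->
  (forall y, y \in O -> saturated (edges_of (P ++ O)) (arc_head y)) ->
  (exists d, walk c d T) -> saturated (edges_of (P ++ O)) c -> uniq (edges_of (P ++ T)) ->
  {subset edges_of T <= edges_of O}.
Proof.
move=> wO satx satO; elim: T c => [|z T IH] c //= [d /andP[/eqP tz w]] satc.
rewrite edges_of_cat cat_uniq /= negb_or -andbA => /and5P[uP zP noT _ uT].
have zO : arc_edge z \in edges_of O.
  by have := satc z tz; rewrite edges_of_cat mem_cat (negbTE zP).
have sat_head : saturated (edges_of (P ++ O)) (arc_head z).
  case/mapP: (zO) => y yO E; case: (eq_arc_edge E) => ->; first exact: satO.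
  by rewrite arc_head_inv; case: (walk_arc_tail wO yO) => [->|[y' y'O ->]] //; apply: satO.
move=> e; rewrite inE => /predU1P[-> //|]; apply: IH sat_head _ e; first by exists d.
by rewrite edges_of_cat cat_uniq uP noT.
Qed.

Lemma saturated_walk_completes P O T x b : uniq (edges_of (P ++ O)) -> completes P x b T ->
  walk x b O -> saturated (edges_of (P ++ O)) x ->
  (forall y, y \in O -> saturated (edges_of (P ++ O)) (arc_head y)) -> completes P x b O.
Proof.
move=> u [wT uT sT] wO satx satO; split=> //.
apply/eqP; rewrite eqn_leq -{1}size_cat size_uniq_edges //= -sT leq_add2l.
rewrite -!size_edges_of; apply: uniq_leq_size.
  by move: uT; rewrite edges_of_cat cat_uniq => /and3P[].
by apply: (saturated_walk_sub wO satx satO _ satx uT); exists b.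
Qed.

(* The state of Hierholzer's algorithm: the trail walked so far is [S], and [O] is the final
   segment of the trail under construction, which was popped from [S]. *)
Definition hierholzer_suffix P x b S O : Prop := (exists T, completes P x b T) ->
  (exists p, walk p b O) /\
  forall y, y \in O -> saturated (edges_of (P ++ S ++ O)) (arc_head y).

Lemma hierholzer_suffix_push P x b S O z : hierholzer_suffix P x b S O ->
  hierholzer_suffix P x b (rcons S z) O.
Proof.
move=> suf /suf[wO sat]; split=> // y yO w /(sat y yO w).
by rewrite cat_rcons !edges_of_cat /= !mem_cat inE => /or3P[]->; rewrite ?orbT.
Qed.

Lemma hierholzer_suffix_pop P x b S O z : uniq (edges_of (P ++ rcons S z ++ O)) ->
  walk x (arc_head z) (rcons S z) -> saturated (edges_of (P ++ rcons S z ++ O)) (arc_head z) ->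
  hierholzer_suffix P x b (rcons S z) O -> hierholzer_suffix P x b S (z :: O).
Proof.
move=> u wS sat suf cT; have [[p wO] satO] := suf cT; have [T c] := cT.
rewrite -cat_rcons; split=> [|y]; last by rewrite inE => /predU1P[->|/satO].
by exists (arc_tail z); rewrite /= eqxx (stuck_vertex u c wS wO sat).
Qed.

Lemma hierholzer_suffix_completes P x b O T : uniq (edges_of (P ++ O)) ->
  saturated (edges_of (P ++ O)) x -> hierholzer_suffix P x b [::] O -> completes P x b T ->
  completes P x b O.
Proof.
move=> u satx suf c; have [|[p wO] satO] := suf; first by exists T.
have xp : x = p by apply: (@stuck_vertex P [::] O T x x p b) => //=.
by subst p; apply: saturated_walk_completes u c wO satx satO.
Qed.

End Completions.

Section CompletionLabels.
Variables (Gamma : groupType) (G : graph) (gamma : arc_of G -> Gamma).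
Hypothesis gammaV : group_labeling gamma.
Implicit Types (a b x : vertex G) (P O T : seq (arc_of G)).

Definition same_completion_labels P x b O : Prop :=
  forall T, completes P x b T -> trail_label gamma T = trail_label gamma O.

Lemma elementary_completesP P x b O : completes P x b O ->
  elementary_trail gamma x O <-> same_completion_labels P x b O.
Proof.
move=> cO; have [w u _] := cO.
have uO : uniq (edges_of O) by move: u; rewrite edges_of_cat cat_uniq => /and3P[].
split=> [el T cT|same].
  have [wT _ _] := cT.
  exact: (elementary_uniform_trail gammaV w uO el wT (completes_perm cO cT)).
apply: (uniform_elementary_trail gammaV w) => T wT pe.
exact/same/(perm_completes cO).
Qed.

Lemma distinct_labels_edges_gt0 a b T T' : eulerian_trail a b T -> eulerian_trail a b T' ->
  trail_label gamma T <> trail_label gamma T' -> 0 < nedges G.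
Proof.
move=> /completes_nilP/completes_nil_size sz /completes_nilP/completes_nil_size sz'.
rewrite lt0n => neq; apply/eqP => m0; apply: neq.
by rewrite m0 in sz sz'; rewrite (size0nil sz) (size0nil sz').
Qed.

End CompletionLabels.

(** * Contents of arrays *)

Section Stored.
Variable mem : nat -> nat.
Implicit Types (w : seq nat).

Definition stored (i : nat) w : Prop := [seq mem j | j <- iota i (size w)] = w.

Lemma stored1 i x : stored i [:: x] <-> mem i = x.
Proof. by split=> [[]|mi] //; rewrite /stored /= mi. Qed.

Lemma stored_cat i w1 w2 : stored i (w1 ++ w2) <-> stored i w1 /\ stored (i + size w1) w2.
Proof.
rewrite /stored size_cat iotaD map_cat; split=> [/eqP|[-> ->] //].
by rewrite eqseq_cat ?size_map ?size_iota // => /andP[/eqP -> /eqP ->].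
Qed.

Lemma stored_nth i w j : stored i w -> j < size w -> mem (i + j) = nth 0 w j.
Proof. by move=> st jw; rewrite -[in RHS]st (nth_map 0) ?size_iota // nth_iota. Qed.

Definition stored_arcs (G : graph) i (s : seq (arc_of G)) : Prop :=
  stored i [seq arc_code z | z <- s].

Lemma stored_arcs_cat (G : graph) i (s1 s2 : seq (arc_of G)) :
  stored_arcs i (s1 ++ s2) <-> stored_arcs i s1 /\ stored_arcs (i + size s1) s2.
Proof. by rewrite /stored_arcs map_cat stored_cat size_map. Qed.

Lemma stored_arcs_rcons (G : graph) i (s : seq (arc_of G)) z :
  stored_arcs i (rcons s z) <-> stored_arcs i s /\ mem (i + size s) = arc_code z.
Proof. by rewrite -cats1 stored_arcs_cat /stored_arcs stored1. Qed.

Lemma stored_arcs_cons (G : graph) i z (s : seq (arc_of G)) :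
  stored_arcs i (z :: s) <-> mem i = arc_code z /\ stored_arcs i.+1 s.
Proof. by rewrite -cat1s stored_arcs_cat /stored_arcs stored1 addn1. Qed.

Lemma stored_arcs_take (G : graph) i (s : seq (arc_of G)) j : stored_arcs i s -> j < size s ->
  exists z, [/\ mem (i + j) = arc_code z, take j.+1 s = rcons (take j s) z &
                drop j s = z :: drop j.+1 s].
Proof.
case: s => // z0 s0; set s := z0 :: s0 => st jw; exists (nth z0 s j); split.
- by rewrite (stored_nth st) ?size_map // (nth_map z0).
- exact: take_nth.
- exact: drop_nth.
Qed.

End Stored.

Lemma stored_ext (mem mem' : nat -> nat) i w :
  (forall j, i <= j < i + size w -> mem' j = mem j) -> stored mem i w -> stored mem' i w.
Proof.
move=> ext st; rewrite /stored -[RHS]st; apply/eq_in_map => j; rewrite mem_iota; exact: ext.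
Qed.

Lemma stored_eq (mem mem' : nat -> nat) i w : mem' =1 mem -> stored mem i w -> stored mem' i w.
Proof. by move=> ext; apply: stored_ext. Qed.

Lemma stored_nth_id w : stored (nth 0 w) 0 w.
Proof. by rewrite /stored map_nth_iota0 // take_size. Qed.

Lemma stored_arcs_stores_trail (G : graph) (a b : vertex G) s t p : eulerian_trail a b p ->
  stored_arcs (arr s t) 0 p -> stores_trail s t p.
Proof.
move=> /completes_nilP/completes_nil_size sz; rewrite /stored_arcs /stored size_map sz.
exact.
Qed.

(** * The programs *)

Local Notation r_out := 0 (only parsing).
Local Notation r_edges := 1 (only parsing).
Local Notation r_source := 2 (only parsing).
Local Notation r_target := 3 (only parsing).
(* A procedure treats the part of a trail that follows its first [r_start] arcs; that part
   starts at the vertex [r_start_vertex]. *)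
Local Notation r_start := 10 (only parsing).
Local Notation r_start_vertex := 11 (only parsing).
Local Notation r_vertex := 12 (only parsing).
Local Notation r_top := 13 (only parsing).
Local Notation r_low := 14 (only parsing).
Local Notation r_found := 15 (only parsing).
Local Notation r_arc := 16 (only parsing).
Local Notation r_index := 17 (only parsing).
Local Notation r_scan := 18 (only parsing).
Local Notation r_ok := 19 (only parsing).
Local Notation r_time1 := 20 (only parsing).
Local Notation r_time2 := 21 (only parsing).
Local Notation r_time := 22 (only parsing).
Local Notation r_old_class := 23 (only parsing).
Local Notation r_new_class := 24 (only parsing).
Local Notation r_verdict := 25 (only parsing).
Local Notation r_length := 30 (only parsing).
Local Notation r_stop := 31 (only parsing).
Local Notation r_pos := 32 (only parsing).
Local Notation r_answer := 34 (only parsing).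
Local Notation r_depth := 40 (only parsing).
Local Notation r_cand := 41 (only parsing).
Local Notation r_done := 42 (only parsing).
Local Notation r_advanced := 43 (only parsing).
Local Notation r_copy := 45 (only parsing).
Local Notation r_entry := 50 (only parsing).
Local Notation r_code := 51 (only parsing).

Local Notation a_out1 := 0 (only parsing).
Local Notation a_out2 := 1 (only parsing).
Local Notation in_arc := 1 (only parsing).
Local Notation in_head := 2 (only parsing).
Local Notation in_label := 3 (only parsing).
(* The arrays from [a_head] to [a_edge] are indexed by arc codes, [a_used] by edges, [a_visit]
   and [a_class] by times, and [a_last], which holds times of last visits, by vertices. *)
Local Notation a_head := 10 (only parsing).
Local Notation a_tail := 11 (only parsing).
Local Notation a_label := 12 (only parsing).
Local Notation a_inv := 13 (only parsing).
Local Notation a_edge := 14 (only parsing).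
Local Notation a_trail := 15 (only parsing).
Local Notation a_best := 16 (only parsing).
Local Notation a_used := 17 (only parsing).
Local Notation a_stack := 18 (only parsing).
Local Notation a_visit := 19 (only parsing).
Local Notation a_class := 22 (only parsing).
Local Notation a_last := 21 (only parsing).
Local Notation a_query := 23 (only parsing).

Section ProgramText.

Local Notation "e1 =e e2" := (EEq e1 e2) (at level 70).
Local Notation "e1 <e e2" := (ELt e1 e2) (at level 70).
Local Notation "e1 +e e2" := (EAdd e1 e2) (at level 50).
Local Notation "e1 -e e2" := (ESub e1 e2) (at level 50).
Local Notation "t .[ e ]" := (EGet t e).
Local Notation "$ r" := (EReg r) (at level 1, format "$ r").
Local Notation "p1 ;; p2" := (PSeq p1 p2) (at level 90, right associativity).
Local Notation one := (ECst 1).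
Local Notation zero := (ECst 0).

Definition tabulate_arcs : prog :=
  PFor r_entry BArcs
    (PSet r_code in_arc.[$r_entry] ;;
     PPut a_head $r_code in_head.[$r_entry] ;;
     PPut a_label $r_code in_label.[$r_entry] ;;
     PIf ($r_code <e $r_edges)
       (PPut a_inv $r_code ($r_code +e $r_edges) ;; PPut a_edge $r_code $r_code)
       (PPut a_inv $r_code ($r_code -e $r_edges) ;;
        PPut a_edge $r_code ($r_code -e $r_edges))).

Definition tabulate_tails : prog :=
  PFor r_entry BArcs (PPut a_tail $r_entry a_head.[a_inv.[$r_entry]]).

Definition clear_used : prog := PFor r_index BEdges (PPut a_used $r_index zero).

Definition mark_used : prog :=
  clear_used ;;
  for_range r_index BEdges zero $r_start (PPut a_used a_edge.[a_trail.[$r_index]] one).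

Definition test_arc : prog :=
  PIf (a_tail.[$r_scan] =e $r_vertex)
    (PIf a_used.[a_edge.[$r_scan]] PSkip (PSet r_found one ;; PSet r_arc $r_scan)) PSkip.

Definition find_arc : prog := PSet r_found zero ;; PFor r_scan BArcs test_arc.

Definition hierholzer_push : prog :=
  PPut a_used a_edge.[$r_arc] one ;; PPut a_stack $r_top $r_arc ;;
  PSet r_top ($r_top +e one) ;; PSet r_vertex a_head.[$r_arc].

Definition hierholzer_pop : prog :=
  PSet r_top ($r_top -e one) ;; PSet r_arc a_stack.[$r_top] ;; PSet r_low ($r_low -e one) ;;
  PPut a_trail $r_low $r_arc ;; PSet r_vertex a_tail.[$r_arc].

Definition hierholzer_step : prog :=
  find_arc ;; PIf $r_found hierholzer_push (PIf $r_top hierholzer_pop PSkip).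

Definition check_arc : prog :=
  PIf (a_tail.[a_trail.[$r_index]] =e $r_vertex) PSkip (PSet r_ok zero) ;;
  PSet r_vertex a_head.[a_trail.[$r_index]].

Definition check_walk : prog :=
  PSet r_ok one ;; PSet r_vertex $r_start_vertex ;;
  for_range r_index BEdges $r_start $r_edges check_arc ;;
  PIf ($r_vertex =e $r_target) PSkip (PSet r_ok zero).

Definition hierholzer : prog :=
  mark_used ;; PSet r_vertex $r_start_vertex ;; PSet r_top zero ;; PSet r_low $r_edges ;;
  PFor r_index BArcs hierholzer_step.

Definition complete_trail : prog :=
  hierholzer ;; PIf ($r_low =e $r_start) check_walk (PSet r_ok zero).

Definition record_visits : prog :=
  PSet r_vertex $r_start_vertex ;;
  for_range r_time1 BTimes $r_start ($r_edges +e one)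
    (PPut a_visit $r_time1 $r_vertex ;; PPut a_class $r_time1 $r_vertex ;;
     PPut a_last $r_vertex $r_time1 ;; PSet r_vertex a_head.[a_trail.[$r_time1]]).

Definition last_visit (r : nat) : expr := a_last.[a_visit.[$r]].

Definition not_crossing : expr :=
  ((last_visit r_time1 <e last_visit r_time2) =e ($r_time1 <e last_visit r_time2)) =e
  ((last_visit r_time1 <e $r_time2) =e ($r_time1 <e $r_time2)).

Definition relabel_class : prog :=
  for_range r_time BTimes $r_start ($r_edges +e one)
    (PIf (a_class.[$r_time] =e $r_old_class) (PPut a_class $r_time $r_new_class) PSkip).

Definition merge_classes : prog :=
  PSet r_old_class a_class.[$r_time1] ;; PSet r_new_class a_class.[$r_time2] ;; relabel_class.

Definition merge_crossing : prog :=
  PIf (a_visit.[$r_time1] =e a_visit.[$r_time2]) PSkip (PIf not_crossing PSkip merge_classes).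

Definition compute_classes : prog :=
  for_pairs r_time1 r_time2 BTimes $r_start ($r_edges +e one) merge_crossing.

Definition append_labels (e : expr) : prog :=
  for_range r_pos BEdges $r_start $r_stop
    (PPut a_query $r_length a_label.[e] ;; PSet r_length ($r_length +e one)).

Definition append_prefix (t : nat) : prog := append_labels t.[$r_pos].

Definition append_inverse (t : nat) : prog :=
  append_labels a_inv.[t.[$r_start +e $r_stop -e one -e $r_pos]].

Definition append_chord (r : nat) : prog :=
  PSet r_stop $r ;; append_prefix a_trail ;; PSet r_stop (last_visit r) ;; append_inverse a_trail.

Definition append_chords : prog := append_chord r_time1 ;; append_chord r_time2.

Definition test_chords : prog :=
  PSet r_length zero ;; append_chords ;; append_chords ;;
  PQuery r_answer a_query $r_length ;; PIf $r_answer PSkip (PSet r_verdict zero).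

Definition test_linked_chords : prog :=
  PSet r_verdict one ;;
  for_pairs r_time1 r_time2 BTimes $r_start ($r_edges +e one)
    (PIf (a_class.[$r_time1] =e a_class.[$r_time2]) test_chords PSkip).

Definition test_elementary : prog := record_visits ;; compute_classes ;; test_linked_chords.

Definition start_prog : prog :=
  tabulate_arcs ;; tabulate_tails ;; PSet r_start zero ;; PSet r_start_vertex $r_source ;;
  complete_trail.

Definition decide_prog : prog :=
  start_prog ;;
  PIf $r_ok (test_elementary ;; PSet r_out $r_verdict) (PSet r_out one).

Definition copy_prefix (t t' r : nat) : prog :=
  for_range r_copy BEdges zero $r (PPut t' $r_copy t.[$r_copy]).

Definition load_prefix : prog :=
  copy_prefix a_best a_trail r_depth ;; PSet r_start $r_depth ;; mark_used.

Definition extend_prefix : prog :=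
  PPut a_trail $r_depth $r_cand ;; PSet r_start ($r_depth +e one) ;;
  PSet r_start_vertex a_head.[$r_cand] ;; complete_trail.

Definition compare_labels : prog :=
  PSet r_start zero ;; PSet r_length zero ;; PSet r_stop $r_edges ;;
  append_prefix a_best ;; append_inverse a_trail ;; PQuery r_answer a_query $r_length.

Definition advance_prog : prog := copy_prefix a_trail a_best r_edges ;; PSet r_advanced one.

Definition examine_rest : prog :=
  PSet r_start ($r_depth +e one) ;; PSet r_start_vertex a_head.[$r_cand] ;; test_elementary ;;
  PIf $r_verdict PSkip advance_prog.

Definition output_prog : prog :=
  copy_prefix a_best a_out1 r_edges ;; copy_prefix a_trail a_out2 r_edges ;; PSet r_done one.

Definition try_arc : prog :=
  extend_prefix ;;
  PIf $r_ok (compare_labels ;; PIf $r_answer examine_rest output_prog) PSkip.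

Definition try_unused_arc : prog :=
  load_prefix ;; PIf a_used.[a_edge.[$r_cand]] PSkip try_arc.

Definition search_step : prog :=
  PIf $r_done PSkip (PIf $r_advanced PSkip
    (PIf (a_tail.[$r_cand] =e a_tail.[a_best.[$r_depth]]) try_unused_arc PSkip)).

Definition search_round : prog := PSet r_advanced zero ;; PFor r_cand BArcs search_step.

Definition search_prog : prog :=
  start_prog ;; copy_prefix a_trail a_best r_edges ;; PSet r_done zero ;;
  PFor r_depth BEdges search_round.

End ProgramText.

Lemma wf_decide : wf decide_prog.
Proof. by []. Qed.

Lemma wf_search : wf search_prog.
Proof. by []. Qed.

Lemma cost_deg_decide : cost_deg decide_prog = 3.
Proof. by []. Qed.

Lemma cost_deg_search : cost_deg search_prog = 5.
Proof. by []. Qed.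

(** * Correctness of the programs *)

Section Specs.
Variables (Gamma : groupType) (k : nat) (gen : 'I_k -> Gamma) (oracle : seq nat -> bool).
Variables (G : graph) (gamma : arc_of G -> Gamma) (lab : arc_of G -> word k).
Hypothesis oracleP : solves_word_problem gen oracle.
Hypothesis gammaV : group_labeling gamma.
Hypothesis labP : word_labeling gen gamma lab.
Hypothesis lab1 : forall x, size (lab x) = 1.

Local Notation m := (nedges G).
Local Notation den := (den oracle).
Implicit Types (z y f : arc_of G) (s : state) (P S O T : seq (arc_of G)).

Definition label_code z : nat := head 0 [seq letter_code l | l <- lab z].

Lemma oracle_label (zs : seq (arc_of G)) :
  oracle [seq label_code z | z <- zs] <-> trail_label gamma zs = 1%g.
Proof.
have -> : [seq label_code z | z <- zs] =
    [seq letter_code l | l <- flatten [seq lab z | z <- zs]].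
  rewrite map_flatten -map_comp; elim: zs => //= z zs ->.
  by rewrite /label_code /=; case: (lab z) (lab1 z) => [|l [|? ?]].
have -> : trail_label gamma zs = eval_word gen (flatten [seq lab z | z <- zs]).
  rewrite /trail_label /eval_word; elim: zs => [|z zs IH] /=; first by rewrite !big_nil.
  by rewrite big_cons big_cat IH /= -(labP z).1.
exact: oracleP.
Qed.

Definition tabulated s z : Prop :=
  [/\ arr s a_head (arc_code z) = arc_head z, arr s a_label (arc_code z) = label_code z,
      arr s a_inv (arc_code z) = arc_code (arc_inv z) &
      arr s a_edge (arc_code z) = arc_edge z].

Definition tables s : Prop :=
  [/\ reg s r_edges = m, forall z, tabulated s z &
      forall z, arr s a_tail (arc_code z) = arc_tail z].

Definition table_arrs : seq nat := [:: a_head; a_tail; a_label; a_inv; a_edge].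

Lemma tables_depends_on : depends_on [:: r_edges] table_arrs tables.
Proof.
move=> s s' er ea [sm tab tail]; split; first by rewrite er.
  by move=> z; case: (tab z) => ? ? ? ?; split; rewrite ea.
by move=> z; rewrite ea.
Qed.

Section Input.
Variables (adj : vertex G -> seq (arc_of G)) (a b : vertex G).
Hypothesis adjP : adjacency_lists adj.
Let entries := adjacency_entries adj.
Let s0 := input_state adj lab a b.

Lemma entries_count z : count_mem z entries = 1.
Proof.
rewrite /entries /adjacency_entries count_flatten -map_comp.
transitivity (sumn [seq (arc_tail z == v : nat) | v <- enum 'I_(nverts G)]).
  congr sumn; apply: eq_map => v /=.
  by have [u E] := adjP v; rewrite count_uniq_mem // E.
rewrite sumn_count (eq_count (a2 := pred1 (arc_tail z))); last by move=> v /=; rewrite eq_sym.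
by rewrite count_uniq_mem ?enum_uniq // mem_enum.
Qed.

Lemma mem_entries z : z \in entries.
Proof. by rewrite -has_pred1 has_count entries_count. Qed.

Lemma entries_uniq : uniq entries.
Proof. by apply: count_mem_uniq => z; rewrite entries_count mem_entries. Qed.

Lemma size_entries : size entries = m + m.
Proof.
have /card_uniqP <- := entries_uniq.
rewrite (eq_card (B := {: 'I_m * bool})); last by move=> z; rewrite mem_entries.
by rewrite card_prod card_ord card_bool muln2 addnn.
Qed.

Lemma index_entries_lt z : index z entries < m + m.
Proof. by rewrite -size_entries index_mem mem_entries. Qed.

Lemma input_entry z : let j := index z entries in
  [/\ arr s0 in_arc j = arc_code z, arr s0 in_head j = arc_head z &
      arr s0 in_label j = label_code z].
Proof.
have zlt : index z entries < size entries by rewrite index_mem mem_entries.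
rewrite /s0 /input_state /= -/entries; split; rewrite ?(nth_map z) ?nth_index ?mem_entries //.
have -> : flatten [seq [seq letter_code l | l <- lab x] | x <- entries] =
    [seq label_code x | x <- entries].
  elim: entries => //= y ys ->; rewrite /label_code.
  by case: (lab y) (lab1 y) => [|l [|? ?]].
by rewrite (nth_map z) ?nth_index ?mem_entries.
Qed.

Lemma entry_at j : j < m + m -> exists z, index z entries = j.
Proof.
rewrite -size_entries => jlt; case E: entries jlt => [//|z0 zs]; rewrite -E => jlt.
by exists (nth z0 entries j); rewrite index_uniq // entries_uniq.
Qed.

Lemma index_entries_inj : injective (index^~ entries).
Proof. by move=> z y E; rewrite -(nth_index z (mem_entries z)) E nth_index ?mem_entries. Qed.

Lemma tabulate_arcs_spec z : tabulated (den tabulate_arcs s0) z.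
Proof.
pose I j s := forall z, index z entries < j -> tabulated s z.
suff : I (m + m) (den tabulate_arcs s0) by apply; apply: index_entries_lt.
apply: (for_rule (I := I)) => // j s jm sj [fr fa] IH {}z zj.
have [y yj] := entry_at jm; have s1 : reg s 1 = m by rewrite fr.
have [arcE headE labelE] : [/\ arr s in_arc j = arc_code y, arr s in_head j = arc_head y &
    arr s in_label j = label_code y] by rewrite !fa // -yj; apply: input_entry.
rewrite !denE /= sj arcE headE labelE s1.
have [->|zy] := eqVneq z y.
  rewrite /tabulated arc_code_inv arc_code_edge.
  by case: (arc_code y < m) => /=; rewrite !eqxx /= ?sj ?arcE ?headE ?labelE ?s1.
have ne : (arc_code z == arc_code y) = false by apply/eqP => /arc_code_inj/eqP; rewrite (negbTE zy).
have {}zj : index z entries < j.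
  by rewrite ltn_neqAle -ltnS zj andbT -yj; apply: contraNneq zy => /index_entries_inj ->.
by have [? ? ? ?] := IH z zj; case: (arc_code y < m); split; rewrite /= ?sj ?arcE ne.
Qed.

Lemma tabulate_tails_spec s : reg s r_edges = m -> (forall z, tabulated s z) ->
  tables (den tabulate_tails s).
Proof.
move=> sm tab; split; first by rewrite reg_den.
  by move=> z; have [? ? ? ?] := tab z; split; rewrite arr_den.
pose I j s' := forall z, arc_code z < j -> arr s' a_tail (arc_code z) = arc_tail z.
suff filled : I (m + m) (den tabulate_tails s) by move=> z; apply/filled/arc_code_lt.
apply: (for_rule (I := I)) => //; first by rewrite sm.
move=> j s' jm sj [fr fa] IH z; rewrite denE /= sj !(fa a_head, fa a_inv) //.
case: eqVneq => [<- _|zj ?]; last by apply: IH; lia.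
have [_ _ -> _] := tab z; have [-> _ _ _] := tab (arc_inv z).
by rewrite arc_head_inv.
Qed.

End Input.

Lemma clear_used_spec s : reg s r_edges = m ->
  forall i, i < m -> arr (den clear_used s) a_used i = 0.
Proof.
move=> sm; pose I j s' := forall i, i < j -> arr s' a_used i = 0.
apply: (for_rule (I := I)) => //= j s' jm sj _ IH i ij; rewrite denE /= sj.
by case: eqVneq => // ne; apply: IH; lia.
Qed.

Definition marks (U : seq (edge G)) s : Prop :=
  forall e : edge G, arr s a_used e = (e \in U).

Lemma mark_used_spec s P : tables s -> reg s r_start = size P -> size P <= m ->
  stored_arcs (arr s a_trail) 0 P -> marks (edges_of P) (den mark_used s).
Proof.
move=> [sm tab _] sq Pm st; have clear := clear_used_spec sm.
apply: (seq_rule (R := fun s1 => forall i, i < m -> arr s1 a_used i = 0)) => //.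
move=> s1 [fr1 fa1] {}clear; rewrite -[P in edges_of P]take_size.
apply: (for_range_rule (I := fun j => marks (edges_of (take j P))) (l := 0)) => //.
- by rewrite /= fr1.
- by rewrite /= fr1 // sm.
- by move=> e; rewrite take0 /= clear.
move=> j s' jP sj [fr fa] IH e; have [z [az -> _]] := stored_arcs_take st jP.
have [_ _ _ edgeE] := tab z.
rewrite denE /= sj !(fa a_edge, fa a_trail) // !(fa1 a_edge, fa1 a_trail) // az edgeE.
rewrite IH /edges_of map_rcons mem_rcons inE.
by rewrite val_eqE; case: eqP.
Qed.

Definition arc_search (U : seq (edge G)) (c : vertex G) j s : Prop :=
  (reg s r_found = 0 /\ forall z, arc_code z < j -> arc_tail z = c -> arc_edge z \in U) \/
  (reg s r_found = 1 /\
   exists z, [/\ reg s r_arc = arc_code z, arc_tail z = c & arc_edge z \notin U]).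

Lemma find_arc_spec s (U : seq (edge G)) (c : vertex G) : tables s -> reg s r_vertex = c ->
  marks U s -> arc_search U c (m + m) (den find_arc s).
Proof.
move=> [sm tab tail] sc su; rewrite /find_arc den_seq den_set.
apply: (for_rule (I := arc_search U c)) => //=; [by rewrite sm | by left |].
move=> j s' jm sj [fr fa] IH; have [y yj] := arc_code_surj jm.
have [_ _ _ edgeE] := tab y.
rewrite /test_arc !denE /= sj !(fa a_tail, fa a_used, fa a_edge) //= fr //= -yj.
rewrite tail edgeE sc su val_eqE.
have old z : z != y -> arc_code z < (arc_code y).+1 -> arc_code z < j.
  by rewrite ltnS leq_eqVlt -yj => zy /predU1P[/arc_code_inj E|//]; rewrite E eqxx in zy.
have [ty|ty] := eqVneq (arc_tail y) c; last first.
  case: IH => [[r0 none]|?]; [left|by right]; split=> // z zj tz.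
  apply: (none _ (old z _ zj) tz).
  by apply: contraNneq ty => <-; rewrite tz.
case: (boolP (arc_edge y \in U)) => yU /=.
  case: IH => [[r0 none]|?]; [left|by right]; split=> // z zj tz.
  by have [->//|zy] := eqVneq z y; apply: (none _ (old z zy zj) tz).
by right; split=> //; exists y; rewrite /= ?sj.
Qed.

Section Hierholzer.
Variables (P : seq (arc_of G)) (x b : vertex G).

Definition hierholzer_state S O (c : vertex G) s : Prop :=
  [/\ reg s r_vertex = c, reg s r_top = size S & reg s r_low = m - size O] /\
  [/\ stored_arcs (arr s a_stack) 0 S, stored_arcs (arr s a_trail) (m - size O) O,
      stored_arcs (arr s a_trail) 0 P & marks (edges_of (P ++ S ++ O)) s] /\
  [/\ uniq (edges_of (P ++ S ++ O)) & walk x c S].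

Lemma hierholzer_state_depends_on S O c :
  depends_on [:: r_vertex; r_top; r_low] [:: a_trail; a_used; a_stack] (hierholzer_state S O c).
Proof.
move=> s s' er ea [[rc rS rO] [[stS stO stP mk] uw]]; split; first by split; rewrite er.
split=> //; split; do ?[by apply: stored_eq; first exact: ea].
by move=> e; rewrite ea.
Qed.

Lemma hierholzer_push_spec s S O z : tables s -> hierholzer_state S O (arc_tail z) s ->
  reg s r_arc = arc_code z -> arc_edge z \notin edges_of (P ++ S ++ O) ->
  hierholzer_state (rcons S z) O (arc_head z) (den hierholzer_push s).
Proof.
move=> [_ tab _] [[_ rS rO] [[stS stO stP mk] [u wS]]] rz zU.
have [headE _ _ edgeE] := tab z.
have perm_push : perm_eq (edges_of (P ++ rcons S z ++ O)) (arc_edge z :: edges_of (P ++ S ++ O)).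
  by rewrite cat_rcons catA edges_of_cat perm_catC /= perm_cons perm_catC -edges_of_cat -catA.
rewrite /hierholzer_push !denE /= rz; split; [split | split; [split|split]] => //=.
- by rewrite rS size_rcons addn1.
- apply/stored_arcs_rcons; split; last by rewrite rS eqxx.
  by apply: stored_ext stS => i; rewrite rS size_map => /andP[_ /ltn_eqF ->].
- move=> e; rewrite /= edgeE (perm_mem perm_push) inE val_eqE mk.
  by case: eqP.
- by rewrite (perm_uniq perm_push) /= zU.
- by rewrite walk_rcons wS eqxx.
Qed.

Lemma hierholzer_pop_spec s S O z c : tables s -> hierholzer_state (rcons S z) O c s ->
  hierholzer_state S (z :: O) (arc_tail z) (den hierholzer_pop s).
Proof.
move=> [_ _ tail] [[_ rS rO] [[/stored_arcs_rcons[stS az] stO stP mk] [u wS]]].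
have := size_uniq_edges u; rewrite !size_cat size_rcons => szm.
have posE : m - size O - 1 = m - size (z :: O) by rewrite /=; lia.
have posS : m - size O = (m - size (z :: O)).+1 by rewrite /=; lia.
rewrite add0n in az; rewrite size_rcons in rS.
rewrite /hierholzer_pop !denE /= rS subn1 /= az rO posE tail.
split; [split | split; [split|split]] => //=.
- apply/stored_arcs_cons; split; first by rewrite eqxx.
  rewrite -posS; apply: stored_ext stO => i /andP[ge _].
  by rewrite gtn_eqF // -posS.
- apply: stored_ext stP => i; rewrite size_map => /andP[_ lt].
  by rewrite ltn_eqF //; lia.
- by move=> e; rewrite /= mk cat_rcons.
- by rewrite -cat_rcons.
- by move: wS; rewrite walk_rcons => /andP[].
Qed.

Definition hierholzer_inv j s : Prop := exists S O c,
  [/\ hierholzer_state S O c s, hierholzer_suffix P x b S O &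
      j = 2 * size O + size S \/ S = [::] /\ saturated (edges_of (P ++ S ++ O)) x].

Lemma hierholzer_step_spec j s : tables s -> hierholzer_inv j s ->
  hierholzer_inv j.+1 (den hierholzer_step s).
Proof.
move=> ts [S [O [c [hs suf progress]]]].
have [[rc _ _] [[_ _ _ mk] [u wS]]] := hs; have found := find_arc_spec ts rc mk.
apply: (seq_rule found) => s1 fr {}found.
have ts1 : tables s1 by apply: frame_depends_on tables_depends_on fr _ ts.
have {}hs : hierholzer_state S O c s1.
  by apply: frame_depends_on (@hierholzer_state_depends_on S O c) fr _ hs.
rewrite den_if /=; case: found => [[-> sat]|[-> [z [rz tz zU]]]] /=; last first.
  exists (rcons S z), O, (arc_head z); split; [|exact: hierholzer_suffix_push|].
    by apply: hierholzer_push_spec; rewrite ?tz.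
  left; case: progress => [->|[S0 satx]]; first by rewrite size_rcons addnS.
  by case/negP: zU; apply: satx; move: wS; rewrite S0 tz => /eqP ->.
have {}sat : saturated (edges_of (P ++ S ++ O)) c by move=> z; apply: sat; apply: arc_code_lt.
have [[_ rS _] _] := hs; rewrite den_if /= rS.
case: (lastP S) => [|S0 z] in hs suf progress u wS sat rS *.
  rewrite den_skip; exists [::], O, c; split=> //.
  by right; split=> //; move: wS => /eqP ->.
have hz : arc_head z = c by move: wS; rewrite walk_rcons => /andP[_ /eqP].
rewrite size_rcons /=; exists S0, (z :: O), (arc_tail z); split.
- exact: hierholzer_pop_spec hs.
- by apply: hierholzer_suffix_pop; rewrite ?hz.
- left; case: progress => [->|[/eqP]]; last by rewrite -size_eq0 size_rcons.
  by rewrite size_rcons /=; lia.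
Qed.

Definition hierholzer_result s : Prop := exists O,
  [/\ reg s r_low = m - size O, stored_arcs (arr s a_trail) (m - size O) O,
      stored_arcs (arr s a_trail) 0 P, uniq (edges_of (P ++ O)) &
      forall T, completes P x b T -> completes P x b O].

Lemma hierholzer_spec s : tables s -> reg s r_start = size P -> reg s r_start_vertex = x ->
  stored_arcs (arr s a_trail) 0 P -> uniq (edges_of P) -> hierholzer_result (den hierholzer s).
Proof.
move=> ts rP rx st uP.
apply: (seq_rule (mark_used_spec ts rP (size_uniq_edges uP) st)) => s1 fr mk.
rewrite !denE /=; set s2 := set_reg _ r_low _.
have ts2 : tables s2 by apply: frame_depends_on tables_depends_on fr _ ts.
have [sm _ _] := ts2.
have : hierholzer_inv (m + m) (den (PFor r_index BArcs hierholzer_step) s2).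
  apply: (for_rule (I := hierholzer_inv)) => //; first by rewrite sm.
    exists [::], [::], x; split; [|by split=> //; exists b; rewrite /=|by left].
    split; first by rewrite /= fr.1 // subn0.
    rewrite /= cats0; split=> //; split=> //.
    by apply: stored_eq st; apply: fr.2.
  move=> j s' _ _ fr'; apply: hierholzer_step_spec.
  exact: frame_depends_on tables_depends_on fr' _ ts2.
case=> [S [O [c [[[_ _ rO] [[_ stO stP _] [u wS]]] suf progress]]]].
have := size_uniq_edges u; rewrite !size_cat => szm.
have {progress} [S0 satx] : S = [::] /\ saturated (edges_of (P ++ S ++ O)) x.
  case: progress => // progress; split; first by apply: size0nil; lia.
  by move=> z _; apply: all_edges => //; rewrite !size_cat; lia.
subst S; exists O; split=> // T; exact: hierholzer_suffix_completes.
Qed.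

End Hierholzer.

Definition trail_at q (x : vertex G) O s : Prop :=
  [/\ tables s, reg s r_start = q, reg s r_start_vertex = x & stored_arcs (arr s a_trail) q O].

Lemma trail_at_depends_on q x O :
  depends_on [:: r_edges; r_start; r_start_vertex] (a_trail :: table_arrs) (trail_at q x O).
Proof.
move=> s s' er ea [ts rq rx st]; split; do ?by rewrite er.
  by apply: (depends_on_sub _ _ tables_depends_on er ea ts).
by apply: stored_eq st; apply: ea.
Qed.

Lemma check_walk_spec s q (x b : vertex G) O : trail_at q x O s -> reg s r_target = b ->
  q + size O = m -> reg (den check_walk s) r_ok = walk x b O.
Proof.
move=> [[sm tab tail] rq rx st] rb qO; rewrite /check_walk den_seq den_set den_seq den_set.
set s1 := set_reg (set_reg s _ _) _ _.
pose I j s' := reg s' r_vertex = end_vertex x (take j O) /\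
  reg s' r_ok = walk x (end_vertex x (take j O)) (take j O).
apply: (seq_rule (R := I (size O)) (Q := fun s' => reg s' r_ok = walk x b O)) => [|s2 fr2].
  apply: (for_range_rule (I := I) (l := q)) => //=; rewrite ?sm ?qO //.
    by rewrite /I take0 /= eqxx rx.
  move=> j s' jO sj [fr fa] [IHv IHw]; have [z [az takeE _]] := stored_arcs_take st jO.
  have [headE _ _ _] := tab z.
  rewrite /I takeE end_vertex_rcons walk_rcons eqxx andbT /check_arc !denE /= sj.
  rewrite !fa //= az tail IHv val_eqE.
  have [tz|tz] := eqVneq (arc_tail z) _; rewrite /= ?sj !fa //= az headE; split=> //.
    by rewrite IHw tz.
  by case: (boolP (walk x (arc_tail z) _)) => // /walk_end E; rewrite E eqxx in tz.
rewrite /I take_size => -[rv rw]; rewrite !denE /= rv (fr2.1 r_target) //= rb val_eqE.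
have [<-//|eb] := eqVneq (end_vertex x O) b.
by rewrite /=; case: (boolP (walk x b O)) => // /walk_end E; rewrite E eqxx in eb.
Qed.

Definition trail_found P (x b : vertex G) s : Prop :=
  (reg s r_ok = 0 /\ forall T, ~ completes P x b T) \/
  (reg s r_ok != 0 /\
   exists2 O, completes P x b O & stored_arcs (arr s a_trail) 0 (P ++ O)).

Lemma complete_trail_spec s P (x b : vertex G) : tables s -> reg s r_start = size P ->
  reg s r_start_vertex = x -> reg s r_target = b -> stored_arcs (arr s a_trail) 0 P ->
  uniq (edges_of P) -> trail_found P x b (den complete_trail s).
Proof.
move=> ts rP rx rb st uP; apply: (seq_rule (hierholzer_spec b ts rP rx st uP)) => s1 fr.
have ts1 : tables s1 by apply: frame_depends_on tables_depends_on fr _ ts.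
case=> O [rO stO stP u compl]; have := size_uniq_edges u; rewrite size_cat => szm.
rewrite den_if_eq /= rO (fr.1 r_start) // rP; case: eqP => [posO|short]; last first.
  left; rewrite denE; split=> // T /compl[_ _ szO]; apply: short.
  by rewrite -szO addnK.
have szO : size P + size O = m by lia.
have ta : trail_at (size P) x O s1 by split; rewrite ?fr.1 // -posO.
have ok := check_walk_spec ta (etrans (fr.1 r_target isT) rb) szO.
rewrite /trail_found ok; case: (boolP (walk x b O)) => w; [right|left]; split=> //; last first.
  by move=> T /compl[wO _ _]; rewrite wO in w.
exists O; first by [].
apply/stored_arcs_cat; rewrite add0n -posO.
by split; [apply: stored_eq stP | apply: stored_eq stO]; apply: arr_den.
Qed.

Definition query_holds (zs : seq (arc_of G)) s : Prop :=
  mkseq (arr s a_query) (reg s r_length) = [seq label_code z | z <- zs].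

Lemma query_spec s zs : tables s -> query_holds zs s -> size zs <= 12 * m ->
  let s' := den (PQuery r_answer a_query (EReg r_length)) s in
  reg s' r_answer != 0 <-> trail_label gamma zs = 1%g.
Proof.
move=> [sm _ _] hz sz; have lenE : reg s r_length = size zs.
  by rewrite -(size_map label_code zs) -hz size_mkseq.
by rewrite /= (den_query _ _ _ sm) /= ?lenE // -lenE hz eqb0 negbK; apply: oracle_label.
Qed.

Lemma append_labels_spec e q R zs s : tables s -> reg s r_start = q ->
  reg s r_stop = q + size R -> q + size R <= m ->
  (forall j s', j < size R -> reg s' r_pos = q + j -> frame (append_labels e) s s' ->
     eval_expr s' e = nth 0 [seq arc_code z | z <- R] j) ->
  query_holds zs s -> query_holds (zs ++ R) (den (append_labels e) s).
Proof.
move=> [sm tab _] rq rstop le read hz; rewrite -[R in zs ++ R]take_size.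
apply: (for_range_rule (I := fun j => query_holds (zs ++ take j R)) (l := q)) => //=.
- by rewrite sm; lia.
- by rewrite take0 cats0.
move=> j s' jR sj fr; rewrite /query_holds => IH.
have [z [codeE -> _]] := stored_arcs_take (stored_nth_id _) jR; rewrite add0n in codeE.
have [_ labelE _ _] := tab z.
rewrite !denE /= (read j s' jR sj fr) codeE (fr.2 a_label) // labelE.
rewrite addn1 mkseqS eqxx -rcons_cat map_rcons -IH; congr rcons.
apply/eq_in_map => i; rewrite mem_iota => /andP[_ lt].
by rewrite ltn_eqF.
Qed.

Lemma append_prefix_spec t q l O zs s : t != a_query -> tables s -> reg s r_start = q ->
  reg s r_stop = q + l -> l <= size O -> q + size O <= m -> stored_arcs (arr s t) q O ->
  query_holds zs s -> query_holds (zs ++ take l O) (den (append_prefix t) s).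
Proof.
move=> t_query ts rq rstop lO qO st; have sz : size (take l O) = l by rewrite size_takel.
apply: (append_labels_spec ts rq); rewrite ?sz //; first by lia.
move=> j s' jl sj [_ fa]; rewrite /= sj fa ?inE //.
by rewrite (stored_nth st) ?size_map ?map_take ?nth_take //; lia.
Qed.

Lemma append_inverse_spec t q l O zs s : t != a_query -> tables s -> reg s r_start = q ->
  reg s r_stop = q + l -> l <= size O -> q + size O <= m -> stored_arcs (arr s t) q O ->
  query_holds zs s -> query_holds (zs ++ rev_walk (take l O)) (den (append_inverse t) s).
Proof.
move=> t_query ts rq rstop lO qO st.
have sz : size (rev_walk (take l O)) = l by rewrite size_rev_walk size_takel.
apply: (append_labels_spec ts rq); rewrite ?sz //; first by lia.
move=> j s' jl sj [fr fa]; rewrite /= sj !fr // rq rstop !fa ?inE //.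
have -> : q + (q + l) - 1 - (q + j) = q + (l - j.+1) by lia.
have lj : l - j.+1 < size O by lia.
have [z [-> _ dropE]] := stored_arcs_take st lj.
have [_ tab _] := ts; have [_ _ -> _] := tab z.
have nthE : nth z O (l - j.+1) = z by rewrite -[l - j.+1]addn0 -nth_drop dropE.
rewrite (nth_map z) ?sz // /rev_walk nth_rev ?size_map ?size_takel //.
by rewrite (nth_map z) ?size_takel ?nth_take ?nthE //; lia.
Qed.

Definition verdict (v : nat) (C : Prop) s : Prop :=
  (reg s r_verdict = v /\ C) \/ (reg s r_verdict = 0 /\ ~ C).

Section TestElementary.
Variables (q : nat) (x : vertex G) (O : seq (arc_of G)).
Hypothesis qO : q + size O = m.
Local Notation n := (size O).
Local Notation vt := (visit_at x O).
Local Notation pl := (prefix_label gamma O).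

Definition visits_recorded (last : vertex G -> nat) s : Prop :=
  (forall i, i <= n -> arr s a_visit (q + i) = vt i) /\
  (forall u i, visit n vt u i -> visit n vt u (last u) /\ arr s a_last u = q + last u).

Lemma visits_recorded_depends_on last :
  depends_on [::] [:: a_visit; a_last] (visits_recorded last).
Proof.
move=> s s' _ ea [recV recL]; split=> [i|u i] vi; first by rewrite ea ?recV.
by rewrite ea //; apply: recL vi.
Qed.

Lemma record_visits_spec s : trail_at q x O s -> exists last,
  visits_recorded last (den record_visits s) /\
  forall i, i <= n -> arr (den record_visits s) a_class (q + i) = vt i.
Proof.
move=> [[sm tab _] rq rx st].
pose I j s' := [/\ j <= n -> reg s' r_vertex = vt j,
  forall i, i < j -> arr s' a_visit (q + i) = vt i /\ arr s' a_class (q + i) = vt i &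
  forall i, i < j -> exists l, [/\ l < j, vt l = vt i & arr s' a_last (vt i) = q + l]].
have [_ recV recL] : I n.+1 (den record_visits s).
  rewrite /record_visits den_seq den_set.
  apply: (for_range_rule (I := I) (l := q)) => //=; rewrite ?sm; try lia.
    by split=> //=; rewrite rx /visit_at take0.
  move=> j s' jn sj [fr fa] [IHv IHV IHL]; rewrite !denE /= sj IHv //; split=> /=.
  - move=> jO; have [z [az takeE _]] := stored_arcs_take st jO; have [headE _ _ _] := tab z.
    by rewrite !fa // az headE /visit_at takeE end_vertex_rcons.
  - move=> i ij; rewrite eqn_add2l; have [-> //|ne] := eqVneq i j.
    by apply: IHV; lia.
  - move=> i ij; rewrite val_eqE; have [E|ne] := eqVneq (vt i) (vt j); first by exists j.
    have [|l [lj vl lastE]] := IHL i; last by exists l; split=> //; apply: ltnW.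
    by have : i != j by [apply: contra_neq ne => ->]; lia.
exists (fun u => arr (den record_visits s) a_last u - q); split; last first.
  by move=> i ilen; have [|_ ->] := recV i.
split=> [i ilen|u i [ilen <-]]; first by have [|-> _] := recV i.
have [|l [ln vl ->]] := recL i; first by [].
by rewrite addKn; split; first split.
Qed.

Section Recorded.
Variable last : vertex G -> nat.
Hypothesis visit_last : forall u i, visit n vt u i -> visit n vt u (last u).

Definition crossing_times (i j : nat) : Prop :=
  vt i != vt j /\ cross (last (vt i)) i (last (vt j)) j.

Definition classes_at (D : nat -> nat -> Prop) s : Prop :=
  [/\ forall i j, i <= n -> j <= n -> vt i = vt j ->
        arr s a_class (q + i) = arr s a_class (q + j),
      forall i j, i <= n -> j <= n -> arr s a_class (q + i) = arr s a_class (q + j) ->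
        linked n vt (vt i) (vt j) &
      forall i j, i <= n -> j <= n -> D i j -> crossing_times i j ->
        arr s a_class (q + i) = arr s a_class (q + j)].

Lemma classes_at_sub (D D' : nat -> nat -> Prop) s :
  (forall i j, i <= n -> j <= n -> D' i j -> D i j) -> classes_at D s -> classes_at D' s.
Proof.
move=> sub [eq_visit eq_class eq_cross]; split=> // i j ilen jn /(sub i j ilen jn).
exact: eq_cross.
Qed.

Lemma crossing_times_linked i j : i <= n -> j <= n -> crossing_times i j ->
  linked n vt (vt i) (vt j).
Proof.
move=> ilen jn [uw x_ij]; apply/interlaced_linked/(interlacedP visit_last).
by split=> //; exists i, j.
Qed.

Lemma relabel_class_spec s c c' : reg s r_edges = m -> reg s r_start = q ->
  reg s r_old_class = c -> reg s r_new_class = c' -> forall i, i <= n ->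
  arr (den relabel_class s) a_class (q + i) =
  if arr s a_class (q + i) == c then c' else arr s a_class (q + i).
Proof.
move=> sm rq rc rc' i ilen; pose I j s' := forall i, arr s' a_class (q + i) =
  if (i < j) && (arr s a_class (q + i) == c) then c' else arr s a_class (q + i).
suff /(_ i) -> : I n.+1 (den relabel_class s) by rewrite ltnS ilen.
apply: (for_range_rule (I := I) (l := q)) => //=; rewrite ?sm; try lia.
move=> j s' jn sj [fr fa] IH i'; have := IH j; rewrite ltnn /= => classE.
rewrite !denE /= sj classE !(fr r_old_class, fr r_new_class) // rc rc'.
case: ifP => cE /=; rewrite ?sj ?eqn_add2l IH ltnS [i' <= j]leq_eqVlt.
  by have [->|ne] := eqVneq i' j; rewrite ?cE.
by have [->|ne] := eqVneq i' j; rewrite // cE !andbF.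
Qed.

Lemma merge_classes_spec s D i0 j0 : reg s r_edges = m -> reg s r_start = q ->
  i0 <= n -> j0 <= n -> crossing_times i0 j0 ->
  reg s r_time1 = q + i0 -> reg s r_time2 = q + j0 -> classes_at D s ->
  classes_at (fun i j => D i j \/ i = i0 /\ j = j0) (den merge_classes s).
Proof.
move=> sm rq i0n j0n cr r1 r2 [eq_visit eq_class eq_cross].
rewrite /merge_classes !den_seq !den_set /=; set s1 := set_reg (set_reg s _ _) _ _.
set A := arr s a_class (q + i0); set B := arr s a_class (q + j0).
have mergeE i : i <= n -> arr (den relabel_class s1) a_class (q + i) =
    if arr s a_class (q + i) == A then B else arr s a_class (q + i).
  by apply: relabel_class_spec; rewrite //= ?r1 ?r2.
have l0 := crossing_times_linked i0n j0n cr.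
split=> i j ilen jn; rewrite !mergeE //.
- by move=> v; rewrite (eq_visit i j).
- case: eqVneq => [iA|_]; case: eqVneq => [jA|_].
  + by move=> _; apply: eq_class; rewrite // iA jA.
  + move=> jB; apply: linked_trans (eq_class _ _ ilen i0n iA) (linked_trans l0 _).
    exact: eq_class.
  + move=> iB; apply: linked_trans (eq_class _ _ ilen j0n iB) (linked_trans (linked_sym l0) _).
    exact: eq_class.
  + exact: eq_class.
- by case=> [d c|[-> ->] _]; [rewrite (eq_cross i j) | rewrite eqxx; case: eqP].
Qed.

Lemma not_crossing_spec s i j : i <= n -> j <= n -> visits_recorded last s ->
  reg s r_time1 = q + i -> reg s r_time2 = q + j ->
  (eval_expr s not_crossing != 0) = ~~ cross (last (vt i)) i (last (vt j)) j.
Proof.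
move=> ilen jn [recV recL] r1 r2; have [_ lastE] := recL _ _ (conj ilen erefl).
have [_ lastE'] := recL _ _ (conj jn erefl).
rewrite /= r1 r2 !recV // lastE lastE' !ltn_add2l /cross /between.
by do 4!case: (_ < _).
Qed.

Lemma merge_crossing_spec s D i j : reg s r_edges = m -> reg s r_start = q ->
  visits_recorded last s -> i <= n -> j <= n ->
  reg s r_time1 = q + i -> reg s r_time2 = q + j -> classes_at D s ->
  classes_at (fun i' j' => D i' j' \/ i' = i /\ j' = j) (den merge_crossing s).
Proof.
move=> sm rq rec ilen jn r1 r2 cl.
have skip : ~ crossing_times i j -> classes_at (fun i' j' => D i' j' \/ i' = i /\ j' = j) s.
  case: cl => [eq_visit eq_class eq_cross] ncr; split=> // i' j' i'n j'n [d|[-> ->] //].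
  exact: eq_cross.
have [recV _] := rec; rewrite /merge_crossing den_if_eq /= r1 r2 !recV // val_eqE.
case: eqP => [v|/eqP v]; first by apply: skip => -[]; rewrite v eqxx.
rewrite den_if (not_crossing_spec ilen jn rec r1 r2).
case: (boolP (cross _ _ _ _)) => cr /=; first exact: merge_classes_spec.
by apply: skip => -[_]; rewrite (negbTE cr).
Qed.

Lemma compute_classes_spec s : reg s r_edges = m -> reg s r_start = q ->
  visits_recorded last s -> (forall i, i <= n -> arr s a_class (q + i) = vt i) ->
  classes_at (fun _ _ => True) (den compute_classes s).
Proof.
move=> sm rq rec classE.
apply: (for_pairs_rule (I := classes_at) (l := q) (n := n.+1)) => //=; rewrite ?sm; try lia.
- by move=> D D' s' sub; apply: classes_at_sub.
- split=> // i j ilen jn; rewrite !classE //; first by move->.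
  by move=> /val_inj ->; apply: linked_refl.
move=> D i j s' ilen jn r1 r2 fr.
apply: merge_crossing_spec; rewrite ?(fr.1 r_edges) ?(fr.1 r_start) //.
exact: frame_depends_on (@visits_recorded_depends_on last) fr _ rec.
Qed.

Lemma classes_linkedP s i j : classes_at (fun _ _ => True) s -> i <= n -> j <= n ->
  arr s a_class (q + i) = arr s a_class (q + j) <-> linked n vt (vt i) (vt j).
Proof.
move=> [eq_visit eq_class eq_cross] ilen jn; split=> [|[l]]; first exact: eq_class.
elim: l i ilen => [|l IH] i ilen /=; first exact: eq_visit.
case=> u /(interlacedP visit_last)[uw [i' [j' [[i'n vi'] [j'n vj'] cr]]]] ch.
rewrite (eq_visit i i') // (eq_cross i' j') //; first by apply: IH; rewrite // vj'.
by split; rewrite vi' vj'.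
Qed.

Definition times_at i j s : Prop :=
  [/\ trail_at q x O s, visits_recorded last s, reg s r_time1 = q + i & reg s r_time2 = q + j].

Lemma times_at_depends_on i j :
  depends_on [:: r_edges; r_start; r_start_vertex; r_time1; r_time2]
    (a_visit :: a_last :: a_trail :: table_arrs) (times_at i j).
Proof.
move=> s s' er ea [ta rec r1 r2]; split; do ?by rewrite er.
  by apply: (depends_on_sub _ _ (@trail_at_depends_on q x O) er ea ta).
by apply: (depends_on_sub _ _ (@visits_recorded_depends_on last) er ea rec).
Qed.

Definition chord_arcs (i : nat) : seq (arc_of G) :=
  take i O ++ rev_walk (take (last (vt i)) O).

Lemma label_chord_arcs i : trail_label gamma (chord_arcs i) = chord_label pl (last (vt i)) i.
Proof. by rewrite label_cat label_rev_walk. Qed.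

Lemma size_chord_arcs i : i <= n -> size (chord_arcs i) <= 2 * m.
Proof.
move=> ilen; have [lastn _] := visit_last (conj ilen erefl : visit n vt (vt i) i).
by rewrite size_cat size_rev_walk !size_takel //; lia.
Qed.

Lemma append_chord_spec s zs r i j l : times_at i j s -> l <= n ->
  r \in [:: r_time1; r_time2] -> reg s r = q + l -> query_holds zs s ->
  query_holds (zs ++ chord_arcs l) (den (append_chord r) s).
Proof.
move=> tms ln rP rl hz.
have [lastn _] := visit_last (conj ln erefl : visit n vt (vt l) l).
have keep := frame_depends_on (@times_at_depends_on i j).
have keep_ij := depends_on_ignores (@times_at_depends_on i j).
rewrite /append_chord catA den_seq den_set /= rl; set s1 := set_reg s r_stop _.
have tms1 : times_at i j s1 by apply: keep_ij.
have [[ts1 rq1 _ st1] _ _ _] := tms1.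
have hz1 : query_holds (zs ++ take l O) (den (append_prefix a_trail) s1).
  by apply: append_prefix_spec ts1 rq1 _ _ _ st1 _; rewrite ?qO.
apply: (seq_rule (Q := query_holds _) hz1) => s2 fr2 hz2.
rewrite den_seq den_set; set s3 := set_reg s2 r_stop _.
have tms2 : times_at i j s2 by apply: keep fr2 _ tms1.
have [[ts3 rq3 _ st3] _ _ _] : times_at i j s3 by apply: keep_ij.
apply: append_inverse_spec ts3 rq3 _ _ _ st3 _; rewrite ?qO //.
have [_ [recV recL] r1 r2] := tms2; have [_ lastE] := recL _ _ (conj ln erefl).
have r2l : reg s2 r = q + l.
  rewrite fr2.1; last by move: rP; rewrite !inE => /orP[]/eqP->.
  by rewrite /s1 /=; move: rP; rewrite !inE => /orP[]/eqP E; rewrite E -rl E.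
by rewrite /= r2l recV.
Qed.

Definition query_at i j zs s : Prop := times_at i j s /\ query_holds zs s.

Lemma append_chords_spec s zs i j : i <= n -> j <= n -> query_at i j zs s ->
  query_at i j (zs ++ chord_arcs i ++ chord_arcs j) (den append_chords s).
Proof.
move=> ilen jn [tms hz]; have keep := frame_depends_on (@times_at_depends_on i j).
split; first exact: keep (den_frame oracle append_chords s) _ tms.
have [_ _ r1 _] := tms; rewrite catA.
apply: (seq_rule (append_chord_spec tms ilen _ r1 hz)) => // s1 fr hz1.
have tms1 : times_at i j s1 by apply: keep fr _ tms.
by have [_ _ _ r2] := tms1; apply: append_chord_spec tms1 jn _ r2 hz1.
Qed.

Lemma test_chords_spec s i j : times_at i j s -> i <= n -> j <= n ->
  verdict (reg s r_verdict)
    (selfinv (chord_label pl (last (vt i)) i * chord_label pl (last (vt j)) j)%g)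
    (den test_chords s).
Proof.
move=> tms ilen jn; set g := (_ * _)%g; set v := reg s r_verdict.
pose word := chord_arcs i ++ chord_arcs j; pose Q := verdict v (selfinv g).
rewrite /test_chords den_seq den_set; set s1 := set_reg s r_length _.
have q1 : query_at i j [::] s1.
  by split=> //; apply: (depends_on_ignores (@times_at_depends_on i j)).
apply: (seq_rule (Q := Q) (append_chords_spec ilen jn q1)) => s2 fr2 q2.
apply: (seq_rule (Q := Q) (append_chords_spec ilen jn q2)) => s3 fr3 [[[ts3 _ _ _] _ _ _] hz3].
have sz : size (word ++ word) <= 12 * m.
  have wordE : size word = size (chord_arcs i) + size (chord_arcs j) by apply: size_cat.
  by rewrite size_cat wordE; have := size_chord_arcs ilen; have := size_chord_arcs jn; lia.
have labelE : trail_label gamma (word ++ word) = (g * g)%g.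
  have -> : g = trail_label gamma word by rewrite /word label_cat !label_chord_arcs.
  exact: label_cat.
have := query_spec ts3 hz3 sz; rewrite labelE => answerP.
apply: (seq_rule (Q := Q) (R := fun s4 => reg s4 r_answer != 0 <-> (g * g)%g = 1%g)) => // s4 fr4.
have vE : reg s4 r_verdict = v by rewrite fr4.1 // fr3.1 // fr2.1.
move=> {}answerP; rewrite !denE /=; case: ifP answerP => _ [to_g of_g].
  by left; split=> //; apply/selfinvP/to_g.
by right; split=> // /selfinvP/of_g.
Qed.

Lemma test_linked_chords_spec s : trail_at q x O s -> visits_recorded last s ->
  classes_at (fun _ _ => True) s ->
  verdict 1 (elementary_trail gamma x O) (den test_linked_chords s).
Proof.
move=> ta rec cl.
pose selfinv_chords i j := linked n vt (vt i) (vt j) ->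
  selfinv (chord_label pl (last (vt i)) i * chord_label pl (last (vt j)) j)%g.
pose Inv (D : nat -> nat -> Prop) s' :=
  (reg s' r_verdict = 1 /\ forall i j, i <= n -> j <= n -> D i j -> selfinv_chords i j) \/
  (reg s' r_verdict = 0 /\ ~ elementary_trail gamma x O).
have elP : elementary_trail gamma x O <->
    forall i j, i <= n -> j <= n -> selfinv_chords i j.
  rewrite /elementary_trail (elementaryP _ visit_last); split=> [el i j ilen jn l|el u w i j l].
    exact: el l _ _.
  by move=> [ilen vi] [jn vj]; rewrite -vi -vj in l *; apply: el.
suff : Inv (fun _ _ => True) (den test_linked_chords s).
  case=> [[r inv]|]; [left; split=> // | by right].
  by apply/elP => i j ilen jn; apply: inv.
rewrite /test_linked_chords den_seq den_set; set s0 := set_reg s _ _.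
have [[sm _ _] rq _ _] := ta.
apply: (for_pairs_rule (I := Inv) (l := q) (n := n.+1)) => //=; rewrite ?sm; try lia.
- move=> D D' s' sub [[r inv]|]; [left | by right]; split=> // i j ilen jn d.
  by apply: inv => //; apply: sub.
- by left.
move=> D i j s' ilen jn r1 r2 fr IH.
have tms : times_at i j s'.
  split=> //; first exact: frame_depends_on (@trail_at_depends_on q x O) fr _ ta.
  exact: frame_depends_on (@visits_recorded_depends_on last) fr _ rec.
have linkedP := classes_linkedP cl ilen jn.
rewrite den_if_eq /= r1 r2 !(fr.2 a_class) //; case: eqP => [/linkedP l|nl]; last first.
  case: IH => [[r inv]|]; [left | by right]; split=> // i' j' i'n j'n [|[-> ->] /linkedP //].
  exact: inv.
have [] := test_chords_spec tms ilen jn; case: IH => [[rv inv]|[rv nel]] [r chords].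
- left; split=> [|i' j' i'n j'n [|[-> ->] _] //]; [by rewrite r | exact: inv].
- by right; split=> //; rewrite r.
- by right; split=> // /elP/(_ i j ilen jn l).
- by right.
Qed.

End Recorded.

Lemma test_elementary_spec s : trail_at q x O s ->
  verdict 1 (elementary_trail gamma x O) (den test_elementary s).
Proof.
move=> ta; have [last [rec classE]] := record_visits_spec ta.
have visit_last u i : visit n vt u i -> visit n vt u (last u) by case: rec => _ recL /recL[].
have := den_frame oracle record_visits s; rewrite /test_elementary den_seq.
move: (den record_visits s) rec classE => s1 rec classE fr1.
have ta1 : trail_at q x O s1 by apply: frame_depends_on (@trail_at_depends_on q x O) fr1 _ ta.
have [[sm _ _] rq _ _] := ta1.
apply: (seq_rule (compute_classes_spec visit_last sm rq rec classE)) => s2 fr2.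
apply: test_linked_chords_spec => //.
  exact: frame_depends_on (@trail_at_depends_on q x O) fr2 _ ta1.
exact: frame_depends_on (@visits_recorded_depends_on last) fr2 _ rec.
Qed.

End TestElementary.

Lemma copy_prefix_spec t t' r s T : t != t' -> r != r_copy -> reg s r = size T ->
  size T <= reg s r_edges -> stored_arcs (arr s t) 0 T ->
  stored_arcs (arr (den (copy_prefix t t' r) s) t') 0 T.
Proof.
move=> tt' rcopy rT Tm; pose I j s' := forall i, i < j -> arr s' t' i = arr s t i.
suff copied : I (size T) (den (copy_prefix t t' r) s).
  by apply: stored_ext => i; rewrite size_map => /andP[_]; apply: copied.
apply: (for_range_rule (I := I) (l := 0)) => //=; first by rewrite /avoids /= inE rcopy.
move=> j s' jT sj [fr fa] IH i ij; rewrite denE /= sj eqxx /=.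
case: eqVneq => [->|ne]; last by apply: IH; lia.
by rewrite fa // inE.
Qed.

Section Main.
Variables (adj : vertex G -> seq (arc_of G)) (a b : vertex G).
Hypothesis adjP : adjacency_lists adj.
Let s0 := input_state adj lab a b.

Definition started s : Prop :=
  [/\ tables s, reg s r_start = 0, reg s r_start_vertex = a, reg s r_target = b &
      trail_found [::] a b s].

Lemma start_spec : started (den start_prog s0).
Proof.
rewrite /start_prog 4!den_seq 2!den_set; set s1 := set_reg (set_reg _ _ _) _ _.
have ts1 : tables s1.
  apply: (depends_on_ignores tables_depends_on) => //.
  apply: (depends_on_ignores tables_depends_on) => //.
  by apply: tabulate_tails_spec => [|z]; [rewrite reg_den | apply: tabulate_arcs_spec].
have source1 : reg s1 r_start_vertex = a by rewrite /s1 /= !reg_den.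
have target1 : reg s1 r_target = b by rewrite /s1 /= !reg_den.
have := complete_trail_spec ts1 (erefl : reg s1 r_start = size [::]) source1 target1 _ _.
have := den_frame oracle complete_trail s1.
move: (den complete_trail s1) => s2 fr found; split; rewrite ?fr.1 //; last exact: found.
exact: frame_depends_on tables_depends_on fr _ ts1.
Qed.

Lemma decide_spec : let s := den decide_prog s0 in
  (reg s r_out = 1 /\ same_eulerian_labels gamma a b) \/
  (reg s r_out = 0 /\ ~ same_eulerian_labels gamma a b).
Proof.
pose Q s := (reg s r_out = 1 /\ same_eulerian_labels gamma a b) \/
  (reg s r_out = 0 /\ ~ same_eulerian_labels gamma a b).
apply: (seq_rule (Q := Q) start_spec) => s1 _ [ts rq rx _ found].
rewrite den_if /=; case: found => [[-> none]|[-> [O cO st]]].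
  left; rewrite denE; split=> // T T' /completes_nilP cT.
  by case: (none T).
have [_ _ szO] := cO; have ta : trail_at 0 a O s1 by [].
apply: (seq_rule (Q := Q) (test_elementary_spec szO ta)) => s2 _.
have sameP := elementary_completesP gammaV cO.
rewrite den_set /Q /=; case=> [[-> /sameP same]|[-> nel]]; [left | right]; split=> //.
  by move=> T T' /completes_nilP/same -> /completes_nilP/same ->.
move=> same; apply/nel/sameP => T cT.
by apply: same; apply/completes_nilP.
Qed.

Definition found_pair s : Prop := reg s r_done != 0 /\ exists p1 p2,
  [/\ stored_arcs (arr s a_out1) 0 p1, stored_arcs (arr s a_out2) 0 p2,
      eulerian_trail a b p1, eulerian_trail a b p2 &
      trail_label gamma p1 <> trail_label gamma p2].

Definition same_labels_after (j : nat) W : Prop :=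
  same_completion_labels gamma (take j W) (end_vertex a (take j W)) b (drop j W).

Definition branching (j : nat) s : Prop := reg s r_done = 0 /\ exists W,
  [/\ stored_arcs (arr s a_best) 0 W, completes [::] a b W & ~ same_labels_after j W].

Section TryArc.
Variables (P W2 : seq (arc_of G)) (y f : arc_of G).
Local Notation W := (P ++ y :: W2).
Hypotheses (cW : completes [::] a b W) (fy : arc_tail f = arc_tail y).
Hypothesis fP : arc_edge f \notin edges_of P.

Definition trying s : Prop :=
  [/\ tables s, stored_arcs (arr s a_best) 0 W, [/\ reg s r_done = 0 & reg s r_advanced = 0] &
      [/\ reg s r_target = b, reg s r_depth = size P & reg s r_cand = arc_code f]].

Lemma trying_depends_on :
  depends_on [:: r_edges; r_target; r_depth; r_cand; r_done; r_advanced] (a_best :: table_arrs)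
    trying.
Proof.
move=> s s' er ea [ts st [rd ra] [rt rj rc]]; split; do ?[by split; rewrite er].
  by apply: (depends_on_sub _ _ tables_depends_on er ea ts).
by apply: stored_eq st; apply: ea.
Qed.

Lemma extend_prefix_spec s : trying s -> stored_arcs (arr s a_trail) 0 P ->
  trail_found (rcons P f) (arc_head f) b (den extend_prefix s).
Proof.
move=> try_s stP; have [ts _ _ [rt rj rc]] := try_s; have [_ tab _] := ts.
have [headE _ _ _] := tab f.
rewrite /extend_prefix den_seq den_put den_seq den_set den_seq den_set /= rj rc addn1 headE.
set s1 := set_arr s _ _ _; have ts1 : tables s1 by apply: depends_on_set_arr tables_depends_on _ ts.
apply: complete_trail_spec; rewrite ?size_rcons //.
- apply/stored_arcs_rcons; rewrite /= add0n eqxx; split=> //.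
  by apply: stored_ext stP => i; rewrite size_map => /andP[_ /ltn_eqF ->].
- rewrite /edges_of map_rcons rcons_uniq fP /=.
  by have [_ + _] := cW; rewrite /= edges_of_cat cat_uniq => /and3P[].
Qed.

Lemma compare_labels_spec s V : trying s -> stored_arcs (arr s a_trail) 0 V -> size V = m ->
  reg (den compare_labels s) r_answer != 0 <-> trail_label gamma W = trail_label gamma V.
Proof.
move=> [ts stW _ _] stV szV; have [sm _ _] := ts; have szW := completes_nil_size cW.
pose Q s' := reg s' r_answer != 0 <-> trail_label gamma W = trail_label gamma V.
rewrite /compare_labels den_seq den_set den_seq den_set den_seq den_set /=; set s1 := set_reg _ _ _.
have ts1 : tables s1 by [].
have stop1 : reg s1 r_stop = 0 + size W by rewrite /= sm szW.
have hz1 : query_holds (take (size W) W) (den (append_prefix a_best) s1).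
  by apply: (append_prefix_spec (zs := [::]) _ ts1 _ stop1); rewrite ?szW.
apply: (seq_rule (Q := Q) hz1) => s2 fr2 {}hz1.
have ts2 : tables s2 by apply: frame_depends_on tables_depends_on fr2 _ ts1.
have hz2 : query_holds (take (size W) W ++ rev_walk (take (size V) V))
    (den (append_inverse a_trail) s2).
  apply: (append_inverse_spec (q := 0)) => //; rewrite ?fr2.1 ?szV //=.
  by apply: stored_eq stV; apply: fr2.2.
apply: (seq_rule (Q := Q) hz2) => s3 fr3; rewrite !take_size => {}hz2.
have ts3 : tables s3 by apply: frame_depends_on tables_depends_on fr3 _ ts2.
have sz : size (W ++ rev_walk V) <= 12 * m.
  by rewrite size_cat size_rev_walk szV szW; lia.
apply: (iff_trans (query_spec ts3 hz2 sz)); rewrite label_cat label_rev_walk //.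
by split=> [/divg1_eq|->]; rewrite ?mulgV.
Qed.

Lemma output_spec s V : trying s -> stored_arcs (arr s a_trail) 0 V -> completes [::] a b V ->
  trail_label gamma W <> trail_label gamma V -> found_pair (den output_prog s).
Proof.
move=> [[sm _ _] stW _ _] stV cV neq.
have szW := completes_nil_size cW; have szV := completes_nil_size cV.
have out1 : stored_arcs (arr (den (copy_prefix a_best a_out1 r_edges) s) a_out1) 0 W.
  by apply: copy_prefix_spec; rewrite ?sm ?szW.
apply: (seq_rule (R := fun s' => stored_arcs (arr s' a_out1) 0 W) out1) => s1 fr1 {}out1.
have out2 : stored_arcs (arr (den (copy_prefix a_trail a_out2 r_edges) s1) a_out2) 0 V.
  apply: copy_prefix_spec; rewrite ?fr1.1 ?sm ?szV //.
  by apply: stored_eq stV; apply: fr1.2.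
apply: (seq_rule (R := fun s' => stored_arcs (arr s' a_out2) 0 V) out2) => s2 fr2 {}out2.
rewrite den_set; split=> //; exists W, V; split=> //; try exact/completes_nilP.
by apply: stored_eq out1; apply: fr2.2.
Qed.

Definition try_result s : Prop :=
  [\/ found_pair s,
      reg s r_advanced != 0 /\ branching (size P).+1 s |
      [/\ reg s r_done = 0, reg s r_advanced = 0, stored_arcs (arr s a_best) 0 W &
        forall T, completes P (arc_tail y) b (f :: T) ->
          trail_label gamma (f :: T) = trail_label gamma (y :: W2)]].

Lemma advance_spec s V : reg s r_edges = m -> reg s r_done = 0 ->
  stored_arcs (arr s a_trail) 0 V -> completes [::] a b V -> ~ same_labels_after (size P).+1 V ->
  try_result (den advance_prog s).
Proof.
move=> sm rd stV cV nsame; have szV := completes_nil_size cV; constructor 2.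
have best : stored_arcs (arr (den (copy_prefix a_trail a_best r_edges) s) a_best) 0 V.
  by apply: copy_prefix_spec; rewrite ?sm ?szV.
pose Q s' := reg s' r_advanced != 0 /\ branching (size P).+1 s'.
apply: (seq_rule (Q := Q) (R := fun s' => stored_arcs (arr s' a_best) 0 V) best) => s1 fr {}best.
rewrite den_set; split=> //; split; first by rewrite /= fr.1.
by exists V.
Qed.

Lemma examine_rest_spec s O : trying s -> completes (rcons P f) (arc_head f) b O ->
  completes [::] a b (rcons P f ++ O) -> stored_arcs (arr s a_trail) 0 (rcons P f ++ O) ->
  trail_label gamma W = trail_label gamma (rcons P f ++ O) -> try_result (den examine_rest s).
Proof.
move=> [ts stW [rd ra] [_ rj rc]] cO cV stV labelE; have [sm tab _] := ts.
have [_ _ szO] := cO; have [headE _ _ _] := tab f.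
rewrite /examine_rest den_seq den_set den_seq den_set /= rj rc headE; set s1 := set_reg _ _ _.
have ta1 : trail_at (size (rcons P f)) (arc_head f) O s1.
  split=> //; first by rewrite /= size_rcons addn1.
  by have /stored_arcs_cat[] := stV.
apply: (seq_rule (test_elementary_spec szO ta1)) => s2 fr verd.
have sm2 : reg s2 r_edges = m by rewrite fr.1.
have rd2 : reg s2 r_done = 0 by rewrite fr.1.
have stV2 : stored_arcs (arr s2 a_trail) 0 (rcons P f ++ O).
  by apply: stored_eq stV; apply: fr.2.
have sameP := elementary_completesP gammaV cO.
rewrite den_if /=; case: verd => [[-> /sameP same]|[-> nel]] /=.
  rewrite den_skip; constructor 3; split=> //; first by rewrite fr.1.
    by apply: stored_eq stW; apply: fr.2.
  move=> T /completes_cons[_ /same labelT]; move: labelE.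
  rewrite cat_rcons !label_cat => /mulgI ->.
  by rewrite /trail_label !big_cons -!/(trail_label gamma _) labelT.
apply: advance_spec sm2 rd2 stV2 cV _; rewrite /same_labels_after -(size_rcons P f).
rewrite take_size_cat // drop_size_cat // end_vertex_rcons => same.
exact/nel/sameP.
Qed.

Lemma try_arc_spec s : trying s -> stored_arcs (arr s a_trail) 0 P -> try_result (den try_arc s).
Proof.
move=> try_s stP; have [wW _ _] := cW.
apply: (seq_rule (extend_prefix_spec try_s stP)) => s1 fr1 found.
have try1 : trying s1 by apply: frame_depends_on trying_depends_on fr1 _ try_s.
have [_ stW1 [rd1 ra1] _] := try1.
rewrite den_if /=; case: found => [[-> none]|[-> [O cO stV]]].
  rewrite denE; constructor 3; split=> // T /completes_cons[_ cT].
  by case: (none T).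
have cV : completes [::] a b (rcons P f ++ O).
  apply: completes_cat cO; rewrite walk_rcons fy eqxx andbT.
  by move: wW; rewrite walk_cat /= => /and3P[wP /eqP -> _].
have szV := completes_nil_size cV.
have cmp := compare_labels_spec try1 stV szV.
pose R s' := reg s' r_answer != 0 <-> trail_label gamma W = trail_label gamma (rcons P f ++ O).
apply: (seq_rule (R := R) cmp) => s2 fr2 {}cmp.
have try2 : trying s2 by apply: frame_depends_on trying_depends_on fr2 _ try1.
have {}stV : stored_arcs (arr s2 a_trail) 0 (rcons P f ++ O).
  by apply: stored_eq stV; apply: fr2.2.
have [same_label answered] := cmp; rewrite den_if /=; case: ifP => answer.
  exact: examine_rest_spec try2 cO cV stV (same_label answer).
by constructor 1; apply: (output_spec try2 stV cV) => /answered; rewrite answer.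
Qed.

End TryArc.
Lemma load_prefix_spec s P Q : tables s -> stored_arcs (arr s a_best) 0 (P ++ Q) ->
  reg s r_depth = size P -> size P <= m ->
  stored_arcs (arr (den load_prefix s) a_trail) 0 P /\ marks (edges_of P) (den load_prefix s).
Proof.
move=> ts /stored_arcs_cat[stP _] rj Pm; have [sm _ _] := ts.
pose post s' := stored_arcs (arr s' a_trail) 0 P /\ marks (edges_of P) s'.
have copied : stored_arcs (arr (den (copy_prefix a_best a_trail r_depth) s) a_trail) 0 P.
  by apply: copy_prefix_spec; rewrite ?sm.
apply: (seq_rule (Q := post) (R := fun s' => stored_arcs (arr s' a_trail) 0 P) copied) => s1 fr.
move=> {}copied; have ts1 : tables s1 by apply: frame_depends_on tables_depends_on fr _ ts.
rewrite den_seq den_set /= fr.1 // rj; set s2 := set_reg s1 r_start _.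
split; first by apply: stored_eq copied; apply: (arr_den oracle (p := mark_used) s2).
exact: mark_used_spec.
Qed.

Lemma try_unused_arc_spec s P y W2 f : completes [::] a b (P ++ y :: W2) ->
  arc_tail f = arc_tail y -> trying P W2 y f s -> try_result P W2 y f (den try_unused_arc s).
Proof.
move=> cW fy try_s; have [ts stW _ [_ rj _]] := try_s.
have Pm : size P <= m by rewrite -(completes_nil_size cW) size_cat leq_addr.
pose loaded s' := stored_arcs (arr s' a_trail) 0 P /\ marks (edges_of P) s'.
apply: (seq_rule (R := loaded) (load_prefix_spec ts stW rj Pm)) => s1 fr [stP mk].
have try1 : trying P W2 y f s1 by apply: frame_depends_on (@trying_depends_on P W2 y f) fr _ try_s.
have [[_ tab _] stW1 [rd ra] [_ _ rc]] := try1; have [_ _ _ edgeE] := tab f.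
rewrite den_if /= rc edgeE mk; case: (boolP (_ \in _)) => fP /=; last exact: try_arc_spec.
rewrite den_skip; constructor 3; split=> // T [_ + _].
rewrite edges_of_cat cat_uniq => /and3P[_ /hasPn/(_ (arc_edge f)) + _].
by rewrite inE eqxx fP => /(_ isT).
Qed.

Definition search_inv j W c s : Prop :=
  [\/ found_pair s, reg s r_advanced != 0 /\ branching j.+1 s |
    [/\ reg s r_done = 0, reg s r_advanced = 0, stored_arcs (arr s a_best) 0 W &
      forall f T, arc_code f < c -> completes (take j W) (end_vertex a (take j W)) b (f :: T) ->
        trail_label gamma (f :: T) = trail_label gamma (drop j W)]].

Lemma search_step_spec j W c s : j < m -> completes [::] a b W -> c < m + m ->
  tables s -> reg s r_target = b -> reg s r_depth = j -> reg s r_cand = c ->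
  search_inv j W c s -> search_inv j W c.+1 (den search_step s).
Proof.
move=> jm cW cm ts rt rj rc; rewrite /search_step; case=> [fd|[ad br]|[rd ra st old]].
- by rewrite den_if /= fd.1 den_skip; constructor 1.
- by rewrite !den_if /= br.1 /= ad den_skip; constructor 2.
rewrite den_if /= rd den_if /= ra den_if_eq /=; have szW := completes_nil_size cW.
have jW : j < size W by rewrite szW.
have [y [ay takeE dropE]] := stored_arcs_take st jW; rewrite add0n in ay.
have [f fc] := arc_code_surj cm; have [_ _ tail] := ts; rewrite -{c cm}fc in rc old *.
have sP : size (take j W) = j by rewrite size_takel // ltnW.
have eW : W = take j W ++ y :: drop j.+1 W by rewrite -dropE cat_take_drop.
have ty : arc_tail y = end_vertex a (take j W).
  by have [wW _ _] := cW; move: wW; rewrite {1}eW walk_cat /= => /and3P[_ /eqP].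
have none s' : reg s' r_done = 0 -> reg s' r_advanced = 0 -> stored_arcs (arr s' a_best) 0 W ->
    (forall T, completes (take j W) (arc_tail y) b (f :: T) ->
       trail_label gamma (f :: T) = trail_label gamma (y :: drop j.+1 W)) ->
    search_inv j W (arc_code f).+1 s'.
  move=> rd' ra' st' new; constructor 3; split=> // g T; rewrite ltnS leq_eqVlt => gf cT.
  case/predU1P: gf cT => [/arc_code_inj -> | lt cT]; last exact: (old _ _ lt cT).
  by rewrite dropE -ty; apply: new.
rewrite rj rc ay !tail val_eqE; have [fy|fy] := eqVneq (arc_tail f) (arc_tail y); last first.
  rewrite den_skip; apply: none => // T /completes_cons[E].
  by rewrite E eqxx in fy.
have try_s : trying (take j W) (drop j.+1 W) y f s by split; rewrite -?eW ?sP.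
have cW' := cW; rewrite eW in cW'.
have [fd|[ad br]|[rd2 ra2 st2 new]] := try_unused_arc_spec cW' fy try_s.
- by constructor 1.
- by constructor 2; rewrite -sP.
- by rewrite -eW in st2; apply: none.
Qed.

Lemma search_round_spec j W s : j < m -> completes [::] a b W -> tables s ->
  reg s r_target = b -> reg s r_depth = j -> reg s r_done = 0 ->
  stored_arcs (arr s a_best) 0 W -> ~ same_labels_after j W ->
  found_pair (den search_round s) \/ branching j.+1 (den search_round s).
Proof.
move=> jm cW ts rt rj rd st nsame; rewrite /search_round den_seq den_set.
set s1 := set_reg s _ _; have ts1 : tables s1 by [].
have : search_inv j W (m + m) (den (PFor r_cand BArcs search_step) s1).
  have [sm _ _] := ts; apply: (for_rule (I := search_inv j W)) => //; first by rewrite /= sm.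
    by constructor 3.
  move=> c s' cm sc fr; apply: search_step_spec; rewrite ?(fr.1 r_target) ?(fr.1 r_depth) //.
  exact: frame_depends_on tables_depends_on fr _ ts1.
case=> [fd|[_ br]|[_ _ _ same]]; [by left | by right | case: nsame => T cT].
case: T cT => [[_ _]|f T cT]; last exact: same (arc_code_lt f) cT.
rewrite addn0 size_takel; first by move=> jE; rewrite jE ltnn in jm.
by rewrite (completes_nil_size cW) ltnW.
Qed.

Lemma search_round_found s : tables s -> found_pair s -> found_pair (den search_round s).
Proof.
move=> [sm _ _] fd; rewrite /search_round den_seq den_set.
apply: (for_rule (n := m + m) (I := fun=> found_pair)) => //; first by rewrite /= sm.
by move=> c s' _ _ _ fd'; rewrite /search_step den_if /= fd'.1 den_skip.
Qed.

Lemma search_spec : ~ same_eulerian_labels gamma a b -> found_pair (den search_prog s0).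
Proof.
move=> nsame; apply: (seq_rule (Q := found_pair) start_spec) => s1 _ [ts1 _ _ rt1 found].
have [W cW st] : exists2 W, completes [::] a b W & stored_arcs (arr s1 a_trail) 0 W.
  case: found => [[_ none]|[_ //]]; exfalso; apply: nsame => T T' /completes_nilP cT.
  by case: (none T).
have [sm1 _ _] := ts1; have szW := completes_nil_size cW.
have best : stored_arcs (arr (den (copy_prefix a_trail a_best r_edges) s1) a_best) 0 W.
  by apply: copy_prefix_spec; rewrite ?sm1 ?szW.
pose R s' := stored_arcs (arr s' a_best) 0 W.
apply: (seq_rule (Q := found_pair) (R := R) best) => s2 fr2 {}best; rewrite den_seq den_set.
have ts2 : tables s2 by apply: frame_depends_on tables_depends_on fr2 _ ts1.
set s3 := set_reg s2 _ _; have ts3 : tables s3 by [].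
have [sm3 _ _] := ts3.
have : found_pair (den (PFor r_depth BEdges search_round) s3) \/
    branching m (den (PFor r_depth BEdges search_round) s3).
  apply: (for_rule (I := fun j s => found_pair s \/ branching j s)) => //.
    right; split=> //; exists W; split=> //.
    rewrite /same_labels_after take0 drop0 => same; apply: nsame => T T'.
    by move=> /completes_nilP/same -> /completes_nilP/same ->.
  move=> j s jm sj fr IH; have ts : tables s by apply: frame_depends_on tables_depends_on fr _ ts3.
  have rt : reg s r_target = b by rewrite fr.1 //= fr2.1.
  case: IH => [fd|[rd [V [stV cV nsameV]]]]; first by left; apply: search_round_found.
  exact: (search_round_spec jm cV ts rt sj rd stV nsameV).
case=> // -[_ [V [_ cV nsameV]]]; case: nsameV => T [_ _].
rewrite -(completes_nil_size cV) take_size drop_size -{2}[size V]addn0.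
by move/addnI/size0nil ->.
Qed.

End Main.
End Specs.

Theorem theorem1p2 (Gamma : groupType) (k : nat) (gen : 'I_k -> Gamma)
    (gen_Gamma : generates gen) :
  exists (decide search : cmd) (C : nat),
  forall (oracle : seq nat -> bool) (phi : nat -> nat),
    solves_word_problem gen oracle ->
    (forall n, n <= phi n) ->
    (forall i j, i <= j -> phi i <= phi j) ->
  forall (G : graph) (gamma : arc_of G -> Gamma) (lab : arc_of G -> word k)
         (adj : vertex G -> seq (arc_of G)) (a b : vertex G),
    connected_graph G ->
    group_labeling gamma ->
    word_labeling gen gamma lab ->
    (forall x, size (lab x) = 1) ->
    adjacency_lists adj ->
    let m := nedges G in
    (exists (t : nat) (s : state),
       [/\ exec oracle phi decide (input_state adj lab a b) t s,
           (0 < m -> t <= C * m ^ 2 * phi (12 * m)) &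
           (reg s 0 = 1 /\ same_eulerian_labels gamma a b) \/
           (reg s 0 = 0 /\ ~ same_eulerian_labels gamma a b)]) /\
    (~ same_eulerian_labels gamma a b ->
     exists (t : nat) (s : state) (p1 p2 : seq (arc_of G)),
       [/\ exec oracle phi search (input_state adj lab a b) t s,
           t <= C * m ^ 4 * phi (12 * m),
           stores_trail s 0 p1 /\ stores_trail s 1 p2,
           eulerian_trail a b p1 /\ eulerian_trail a b p2 &
           trail_label gamma p1 <> trail_label gamma p2]).
Proof.
pose c_decide := (2 ^ 2).*2 * cost_coef decide_prog.
pose c_search := (2 ^ 4).*2 * cost_coef search_prog.
exists (compile decide_prog), (compile search_prog), (c_decide + c_search).
move=> oracle phi oracleP phi_ge phi_mono G gamma lab adj a b _ gammaV labP lab1 adjP m.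
have m_phi : m <= phi (12 * m) by apply: leq_trans (phi_ge _); rewrite leq_pmull.
have edgesE : reg (input_state adj lab a b) 1 = m by [].
split=> [|nsame].
  have [t ex le] := exec_within oracle phi_mono wf_decide edgesE m_phi cost_deg_decide
    (leq_addr c_search c_decide).
  exists t, (den oracle decide_prog (input_state adj lab a b)); split=> //.
  exact: (decide_spec oracleP gammaV labP lab1 _ _ adjP).
have [t ex le] := exec_within oracle phi_mono wf_search edgesE m_phi cost_deg_search
  (leq_addl c_decide c_search).
have [_ [p1 [p2 [st1 st2 eul1 eul2 neq]]]] := search_spec oracleP gammaV labP lab1 adjP nsame.
exists t, (den oracle search_prog (input_state adj lab a b)), p1, p2; split=> //.
- exact/le/(distinct_labels_edges_gt0 eul1 eul2 neq).
- by split; [apply: stored_arcs_stores_trail eul1 _ | apply: stored_arcs_stores_trail eul2 _].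
Qed.
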